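(* Let $t_0<t_1$ be real numbers, let $X$ be a Banach space, let $p>1$ and $\gamma\geq (p-1)/p$. Then $$J^{1/p}_{t_0,t}:L^p(t_0,t_1;X)\rightarrow BMO(t_0,t_1;X)\cap K_\gamma(t_0,t_1;X)$$ is a bounded linear operator, i.e., there exists $K>0$ such that $$\|J_{t_0,t}^{1/p}f\|_{\gamma}\leq K\|f\|_{L^p(t_0,t_1;X)}$$ for every $f\in L^p(t_0,t_1;X)$.
   Context: $L^r(t_0,t_1;X)$ is the Bochner–Lebesgue space of (classes of) Bochner measurable functions $f:[t_0,t_1]\to X$ with $\|f(\cdot)\|_X\in L^r(t_0,t_1;\mathbb{R})$, with its usual norm. Riemann–Liouville fractional integral of order $\alpha>0$: $J_{t_0,t}^\alpha f(t)=\frac{1}{\Gamma(\alpha)}\int_{t_0}^t(t-s)^{\alpha-1}f(s)\,ds$ (for a.e. $t\in[t_0,t_1]$). $BMO(t_0,t_1;X)$ is the vector space of all $f\in L^1_{loc}(t_0,t_1;X)$ (i.e. $f\in L^1(K;X)$ for every compact $K\subset(t_0,t_1)$) such that $$[f]_{BMO(t_0,t_1;X)}:=\sup_{[a,b]\subset(t_0,t_1)}\frac{1}{b-a}\int_a^b\|f(s)-\operatorname{avg}_{[a,b]}(f)\|_X\,ds<\infty,\qquad \operatorname{avg}_{[a,b]}(f):=\frac{1}{b-a}\int_a^b f(s)\,ds.$$ For $\gamma>0$, $K_\gamma(t_0,t_1;X)$ is the space of all $f\in\bigcap_{r\geq1}L^r(t_0,t_1;X)$ ($r$ ranging over real numbers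 in $[1,\infty)$) such that $$\|f\|_{K_\gamma(t_0,t_1;X)}:=\sup\{r^{-\gamma}\|f\|_{L^r(t_0,t_1;X)}:r\geq1\}<\infty.$$ On $BMO(t_0,t_1;X)\cap K_\gamma(t_0,t_1;X)$ the norm is $\|\phi\|_\gamma:=[\phi]_{BMO(t_0,t_1;X)}+\|\phi\|_{K_\gamma(t_0,t_1;X)}$. *)

(* Defs.v *)
From mathcomp Require Import all_boot all_order all_algebra.
From mathcomp Require Import all_classical all_reals all_analysis.

Set Implicit Arguments.
Unset Strict Implicit.
Unset Printing Implicit Defensive.

Import Order.TTheory GRing.Theory Num.Theory.
Import numFieldNormedType.Exports.

Local Open Scope classical_set_scope.
Local Open Scope ring_scope.

(** Bochner integration. [D] is meant to be measurable. The sigma-algebra need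
    not be complete: the limits are only required almost everywhere, so over the
    Borel sets of the line the functions below are the strongly
    Lebesgue-measurable ones. For a norm that is only measurable up to a
    negligible set, the integral of the library (a supremum over the measurable
    nonnegative simple functions below it) agrees with that of the completed
    measure. *)

Definition simple_fun (d : measure_display) (T : measurableType d)
    (X : choiceType) (s : T -> X) : Prop :=
  finite_set (range s) /\ forall v : X, measurable (s @^-1` [set v]).

Definition bochner_measurable (d : measure_display) (T : measurableType d)
    (R : realType) (X : completeNormedModType R)
    (mu : {measure set T -> \bar R}) (D : set T) (f : T -> X) : Prop :=
  exists2 s : nat -> T -> X, (forall n, simple_fun (s n)) &
    {ae mu, forall x, D x -> s n x @[n --> \oo] --> f x}.

Definition simple_integrable (d : measure_display) (T : measurableType d)
    (R : realType) (X : completeNormedModType R)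
    (mu : {measure set T -> \bar R}) (D : set T) (s : T -> X) : Prop :=
  simple_fun s /\
  forall v : X, v != 0 -> (mu (D `&` s @^-1` [set v]) < +oo)%E.

(** The value [0] contributes nothing, even when [mu (D `&` s @^-1` [set 0])] is
    infinite. *)
Definition simple_integral (d : measure_display) (T : measurableType d)
    (R : realType) (X : completeNormedModType R)
    (mu : {measure set T -> \bar R}) (D : set T) (s : T -> X) : X :=
  \sum_(v \in range s) fine (mu (D `&` s @^-1` [set v])) *: v.

Definition bochner_approx (d : measure_display) (T : measurableType d)
    (R : realType) (X : completeNormedModType R)
    (mu : {measure set T -> \bar R}) (D : set T) (f : T -> X)
    (s : nat -> T -> X) : Prop :=
  [/\ forall n, simple_integrable mu D (s n),
      {ae mu, forall x, D x -> s n x @[n --> \oo] --> f x} &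
      (\int[mu]_(x in D) (`|f x - s n x|)%:E)%E @[n --> \oo] --> 0%E].

Definition bochner_integrable (d : measure_display) (T : measurableType d)
    (R : realType) (X : completeNormedModType R)
    (mu : {measure set T -> \bar R}) (D : set T) (f : T -> X) : Prop :=
  exists s, bochner_approx mu D f s.

(** The limit does not depend on the approximating sequence; the value is [0]
    when [f] is not integrable. *)
Definition bochner_integral (d : measure_display) (T : measurableType d)
    (R : realType) (X : completeNormedModType R)
    (mu : {measure set T -> \bar R}) (D : set T) (f : T -> X) : X :=
  xget 0 [set v | exists2 s, bochner_approx mu D f s &
                  simple_integral mu D (s n) @[n --> \oo] --> v].

(** The elements of the function spaces are represented by functions on the
    whole line of which only the restriction to the domain matters. *)

Definition Lr_norm (R : realType) (X : completeNormedModType R)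
    (D : set R) (r : R) (f : R -> X) : \bar R :=
  ('N[@lebesgue_measure R]_(r%:E)[EFin \o ((fun x => `|f x|%R) \_ D)%R])%E.

Definition in_Lr (R : realType) (X : completeNormedModType R)
    (D : set R) (r : R) (f : R -> X) : Prop :=
  bochner_measurable (@lebesgue_measure R) D f /\ (Lr_norm D r f < +oo)%E.

Definition Gamma (R : realType) (a : R) : R :=
  \int[@lebesgue_measure R]_(x in `]0, +oo[) (x `^ (a - 1) * expR (- x)).

Definition RL_kernel (R : realType) (X : completeNormedModType R)
    (alpha : R) (f : R -> X) (t : R) : R -> X :=
  fun s => (t - s) `^ (alpha - 1) *: f s.

Definition RL_integral (R : realType) (X : completeNormedModType R)
    (t0 alpha : R) (f : R -> X) (t : R) : X :=
  (Gamma alpha)^-1 *: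
    bochner_integral (@lebesgue_measure R) `[t0, t] (RL_kernel alpha f t).

Definition in_L1loc (R : realType) (X : completeNormedModType R)
    (t0 t1 : R) (f : R -> X) : Prop :=
  forall K : set R, compact K -> K `<=` `]t0, t1[ -> in_Lr K 1 f.

Definition avg (R : realType) (X : completeNormedModType R)
    (a b : R) (f : R -> X) : X :=
  (b - a)^-1 *: bochner_integral (@lebesgue_measure R) `[a, b] f.

Definition mean_oscillation (R : realType) (X : completeNormedModType R)
    (a b : R) (f : R -> X) : \bar R :=
  (((b - a)^-1)%:E *
    \int[@lebesgue_measure R]_(s in `[a, b]) (`|f s - avg a b f|)%:E)%E.

Definition BMO_seminorm (R : realType) (X : completeNormedModType R)
    (t0 t1 : R) (f : R -> X) : \bar R :=
  ereal_sup [set y | exists a b : R,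
    [/\ a < b, `[a, b] `<=` `]t0, t1[ & y = mean_oscillation a b f]].

Definition in_BMO (R : realType) (X : completeNormedModType R)
    (t0 t1 : R) (f : R -> X) : Prop :=
  in_L1loc t0 t1 f /\ (BMO_seminorm t0 t1 f < +oo)%E.

Definition K_norm (R : realType) (X : completeNormedModType R)
    (t0 t1 gamma : R) (f : R -> X) : \bar R :=
  ereal_sup [set ((r `^ (- gamma))%:E * Lr_norm `[t0, t1] r f)%E
            | r in [set r : R | 1 <= r]].

Definition in_K (R : realType) (X : completeNormedModType R)
    (t0 t1 gamma : R) (f : R -> X) : Prop :=
  (forall r : R, 1 <= r -> in_Lr `[t0, t1] r f) /\
  (K_norm t0 t1 gamma f < +oo)%E.

Definition BMO_K_norm (R : realType) (X : completeNormedModType R)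
    (t0 t1 gamma : R) (f : R -> X) : \bar R :=
  (BMO_seminorm t0 t1 f + K_norm t0 t1 gamma f)%E.

Definition ae_eq_on (R : realType) (X : completeNormedModType R)
    (D : set R) (f g : R -> X) : Prop :=
  {ae @lebesgue_measure R, forall t, D t -> f t = g t}.

(* Main.v *)
(** With [q] the exponent conjugate to [p], the kernel of the operator is
    [u `^ (- q^-1)].

    Moments: writing the kernel as a product of two powers, the small one having
    exponent [1 / (2 r)], two applications of Hoelder's inequality bound
    [|J f t| ^ r], up to [r ^ (r / q)], by the integral of
    [(t - s) `^ (- 1/2) * |f s| ^ p] in [s]; integrating in [t] gives
    [||J f||_r <= C r ^ (1/q) ||f||_p] for large [r], and [1/q <= gamma].

    Mean oscillation: on [[a, b]] of length [w], compare [J f t] with the constant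
    obtained by freezing [t] at [a] and keeping only [s < a - w]. After Tonelli the
    difference pairs [|f s|] with a function bounded by [w^2 (a - s) ^ (- 1/q - 1)]
    for [s < a - w] and by a multiple of [w ^ (1/p)] for [s] near [[a, b]], and
    the norm of this function in [L^q] is [O(w)].

    Measurability: [J f t] is the limit of integrals whose kernel depends on [t]
    only through the step of length [1/(n+1)] containing [t]; as functions of [t]
    these are simple, whatever their values. *)

Require Import Defs.
From mathcomp Require Import all_boot all_order all_algebra.
From mathcomp Require Import all_classical all_reals all_analysis.
From mathcomp Require Import measurable_realfun ring lra.

Import Order.TTheory GRing.Theory Num.Theory.
Import numFieldNormedType.Exports.

Local Open Scope classical_set_scope.
Local Open Scope ring_scope.

Set Implicit Arguments.
Unset Strict Implicit.

(** The kernel [u ^ (- 1/q)] just misses [L^q]: its [q]-th power is [1/u]. Hoelder alone gives no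
    supremum bound, and each estimate avoids the logarithmic divergence in its own way. Lowering the
    exponent by [1 / (2 r)] makes the [q]-th power integrable, with an integral of order [r], whence
    the factor [r ^ (1/q)].

    The integral over [[t0, t]] exists only for almost every [t], and elsewhere [J f t] is a default
    value. So [f] is replaced by a representative that is an everywhere limit of simple functions
    and vanishes off [[t0, t1]], and the kernel by one that vanishes at nonpositive arguments: the
    domain becomes the whole line and no longer moves with [t]. The scalar potential of [|f|] is the
    test for existence, and its first moment is finite.

    Estimates are stated for any [m > 0] above the norm of [f], so that powers of [m] may be
    divided; a norm equal to 0 is reached by letting [m] decrease to it. *)

(** ** Lower integrals *)

(* The functions integrated in Defs are only almost everywhere equal to Borel
   functions, so these comparisons assume no measurability: the library integral
   of a nonnegative function is a supremum over simple functions. *)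
Section ae_lower_integral.
Context d (T : measurableType d) (R : realType).
Variable mu : {measure set T -> \bar R}.
Local Open Scope ereal_scope.
Import HBNNSimple.

Lemma le_lower_integral (D : set T) (f g : T -> \bar R) :
  (forall x, D x -> 0 <= f x) -> (forall x, D x -> f x <= g x) ->
  \int[mu]_(x in D) f x <= \int[mu]_(x in D) g x.
Proof.
move=> f0 fg.
have g0 x : D x -> 0 <= g x by move=> Dx; exact: le_trans (f0 _ Dx) (fg _ Dx).
rewrite !ge0_integralE//; apply: ge_ereal_sup => _ /= [h hf <-].
apply: ereal_sup_ubound; exists h => // x; apply: le_trans (hf x) _.
by apply: lee_restrict => // y /set_mem /fg.
Qed.

(** The null set is removed from each simple function below [f], which is measurable, and not from
    [f], which need not be; what remains lies below [g]. *)
Lemma ae_le_lower_integral (D : set T) (f g : T -> \bar R) :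
  (forall x, D x -> 0 <= f x) -> (forall x, D x -> 0 <= g x) ->
  {ae mu, forall x, D x -> f x <= g x} ->
  \int[mu]_(x in D) f x <= \int[mu]_(x in D) g x.
Proof.
move=> f0 g0 [N [mN N0 fgN]].
rewrite {1}ge0_integralE//; apply: ge_ereal_sup => _ /= [h hf <-].
rewrite -integralT_nnsfun (ge0_negligible_integral mN)//; last 2 first.
- exact/measurable_EFinP.
- by move=> x _; rewrite lee_fin.
rewrite integral_mkcond [leRHS]integral_mkcond; apply: le_lower_integral => x _.
  by rewrite patchE; case: ifPn => // _; rewrite lee_fin.
rewrite patchE; case: ifPn => [/set_mem[_ Nx]|_]; last exact: erestrict_ge0.
apply: le_trans (hf x) _; rewrite !patchE; case: ifPn => // /set_mem Dx.
by apply: contrapT => nfg; apply/Nx/fgN => /(_ Dx).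
Qed.

Lemma ae_eq_lower_integral (D : set T) (f g : T -> \bar R) :
  (forall x, D x -> 0 <= f x) -> (forall x, D x -> 0 <= g x) ->
  {ae mu, forall x, D x -> f x = g x} ->
  \int[mu]_(x in D) f x = \int[mu]_(x in D) g x.
Proof.
move=> f0 g0 fg; apply/eqP; rewrite eq_le.
by rewrite !ae_le_lower_integral//; apply: filterS fg => x fg /fg ->.
Qed.

End ae_lower_integral.

(** ** The Bochner integral *)

Section simple_functions.
Context d (T : measurableType d).

Lemma simple_fun_preimage (Q : choiceType) (q : T -> Q) (B : set Q) :
  simple_fun q -> measurable (q @^-1` B).
Proof.
move=> [fq mq]; rewrite (_ : _ @^-1` _ = \bigcup_(z in range q `&` B) q @^-1` [set z]).
  by apply: fin_bigcup_measurable => //; exact: finite_setIl.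
by apply/seteqP; split=> [x Bx|x [z [_ Bz] /= ->]//]; exists (q x).
Qed.

(** [F] is arbitrary: every set of values has a measurable preimage, being a finite union of fibres.
    So a function of a simple index is simple without any regularity of that function. *)
Lemma simple_fun_comp (Q Q' : choiceType) (F : Q -> Q') (q : T -> Q) :
  simple_fun q -> simple_fun (F \o q).
Proof.
move=> sq; split=> [|v]; last exact: (@simple_fun_preimage _ q (F @^-1` [set v])).
rewrite (_ : range _ = F @` range q); first by apply: finite_image; case: sq.
by rewrite image_comp.
Qed.

Lemma simple_fun_pair (Q Q' : choiceType) (q : T -> Q) (q' : T -> Q') :
  simple_fun q -> simple_fun q' -> simple_fun (fun x => (q x, q' x)).
Proof.
move=> [fq mq] [fq' mq']; split=> [|[u v]].
  apply: (@sub_finite_set _ _ (range q `*` range q')); last exact: finite_setX.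
  by move=> _ [x _ <-]; split; exists x.
rewrite (_ : _ @^-1` _ = q @^-1` [set u] `&` q' @^-1` [set v]).
  exact: measurableI.
by apply/seteqP; split=> x /= [-> ->].
Qed.

Lemma simple_fun_cst (Q : choiceType) (c : Q) : simple_fun (fun _ : T => c).
Proof.
split=> [|v]; last by rewrite preimage_cst; case: ifPn.
by apply: (@sub_finite_set _ _ [set c]) => // _ [x _ <-].
Qed.

Lemma simple_fun_mem (A : set T) : measurable A -> simple_fun (fun x => x \in A).
Proof.
move=> mA; split=> [|[]]; first exact: finite_finset.
  rewrite [X in measurable X](_ : _ = A)//.
  by apply/seteqP; split=> x /=; [exact: set_mem|exact: mem_set].
rewrite [X in measurable X](_ : _ = ~` A); first exact: measurableC.
apply/seteqP; split=> x /= Ax; last by apply/negbTE; rewrite notin_setE.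
by rewrite -notin_setE Ax.
Qed.

Lemma simple_fun_measurable (R : realType) (Q : choiceType) (F : Q -> R) (q : T -> Q) :
  simple_fun q -> measurable_fun [set: T] (F \o q).
Proof.
move=> sq _ B mB; rewrite setTI.
exact: (@simple_fun_preimage _ q (F @^-1` B)).
Qed.

End simple_functions.

Section simple_integral.
Context d (T : measurableType d) (R : realType) (X : completeNormedModType R).
Variables (mu : {measure set T -> \bar R}) (D : set T).
Hypothesis mD : measurable D.

Let mDpre (Q : choiceType) (q : T -> Q) (B : set Q) :
  simple_fun q -> measurable (D `&` q @^-1` B).
Proof. by move=> sq; apply: measurableI => //; exact: simple_fun_preimage. Qed.

(** The integral may be computed on the finer partition into fibres of [q]. Since [fine] is additive
    only on finite measures, fibres where [F] is nonzero must be finite; the value 0 is treated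
    apart. *)
Lemma simple_integral_comp (Q : choiceType) (q : T -> Q) (F : Q -> X) :
  simple_fun q ->
  (forall z, F z != 0 -> (mu (D `&` q @^-1` [set z]) < +oo)%E) ->
  simple_integral mu D (F \o q) =
  \sum_(z \in range q) fine (mu (D `&` q @^-1` [set z])) *: F z.
Proof.
move=> sq fF; have [fq mq] := sq; have [fFq _] := simple_fun_comp F sq.
rewrite /simple_integral.
transitivity (\sum_(v \in range (F \o q)) \sum_(z \in range q)
    if F z == v then fine (mu (D `&` q @^-1` [set z])) *: v else 0).
  apply: eq_fsbigr => v _; have [->|v0] := eqVneq v 0.
    rewrite scaler0 fsbig1// => z _; case: ifP => // _; exact: scaler0.
  rewrite (_ : D `&` _ = \bigcup_(z in range q `&` F @^-1` [set v]) (D `&` q @^-1` [set z])).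
    rewrite measure_fin_bigcup; last 3 first.
    - exact: finite_setIl.
    - by move=> z z' _ _ [x [[_ /= <-] [_ /= <-]]].
    - by move=> z _; exact: mDpre.
    transitivity (\sum_(z \in range q `&` F @^-1` [set v])
        fine (mu (D `&` q @^-1` [set z])) *: v); last first.
      rewrite fsbig_mkcondr; apply: eq_fsbigr => z _; congr (if _ then _ else _).
      by apply/idP/eqP => [/set_mem//|zv]; exact: mem_set.
    have fI : finite_set (range q `&` F @^-1` [set v]) by exact: finite_setIl.
    rewrite !fsbig_finite// -scaler_suml big_seq [in RHS]big_seq.
    rewrite sum_fine// => z; rewrite in_fset_set// => /set_mem[_ /= zv].
    by rewrite ge0_fin_numE// fF// zv.
  apply/seteqP; split=> [x [Dx /= Fv]|x [z [_ /= zv] [Dx /= xz]]].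
    by exists (q x).
  by split=> //=; rewrite xz.
rewrite exchange_fsbig//; apply: eq_fsbigr => z /set_mem [x _ xz].
rewrite (fsbigD1 (F z))//=; last by exists x => //=; rewrite xz.
rewrite eqxx fsbig1 ?addr0// => v [_ /= vz]; rewrite ifF//.
by apply/negbTE/eqP => zv; exact: vz.
Qed.


Lemma simple_integrable_lin (c : R) (s s' : T -> X) :
  simple_integrable mu D s -> simple_integrable mu D s' ->
  simple_integrable mu D (fun x => c *: s x + s' x).
Proof.
move=> [ss fs] [ss' fs'].
have sp := simple_fun_pair ss ss'.
have slin := simple_fun_comp (fun z : X * X => c *: z.1 + z.2) sp.
split=> // v v0.
apply: (@le_lt_trans _ _ (mu (D `&` s @^-1` [set~ 0] `|` D `&` s' @^-1` [set~ 0]))).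
  apply: le_measure; rewrite ?inE; first exact: mDpre.
    by apply: measurableU; exact: mDpre.
  move=> x [Dx /= xv]; have [s0|/eqP s0] := eqVneq (s x) 0; [right|by left].
  split=> //= s'0; move: v0; rewrite -xv s0 s'0.
  by rewrite scaler0 addr0 eqxx.
have fin (u : T -> X) : simple_integrable mu D u -> (mu (D `&` u @^-1` [set~ 0%R]) < +oo)%E.
  move=> [[fu mu_] fu']; rewrite (_ : D `&` _ = \bigcup_(v in range u `\ 0) (D `&` u @^-1` [set v])).
    rewrite measure_fin_bigcup; last 3 first.
    - exact: finite_setD.
    - by move=> z z' _ _ [x [[_ /= <-] [_ /= <-]]].
    - by move=> z _; exact: measurableI.
    rewrite fsbig_finite; last exact: finite_setD.
    rewrite big_seq; apply: lte_sum_pinfty => z; rewrite in_fset_set; last exact: finite_setD.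
    by move=> /set_mem[_ /eqP z0]; exact: fu'.
  apply/seteqP; split=> [x [Dx /= ux]|x [z [_ /= z0] [Dx /= xz]]].
    by exists (u x) => //; split=> //; exists x.
  by split=> //=; rewrite xz.
apply: le_lt_trans (measureU2 _ _ _) _; [exact: mDpre..|].
by rewrite lte_add_pinfty// fin.
Qed.

(** All three integrals are computed on the common partition given by the pair [(s, s')]. *)
Lemma simple_integral_lin (c : R) (s s' : T -> X) :
  simple_integrable mu D s -> simple_integrable mu D s' ->
  simple_integral mu D (fun x => c *: s x + s' x) =
  c *: simple_integral mu D s + simple_integral mu D s'.
Proof.
move=> [ss fs] [ss' fs'].
pose q x := (s x, s' x); have sq : simple_fun q := simple_fun_pair ss ss'.
have [fq mq] := sq.
have fst_fin z : z.1 != 0 -> (mu (D `&` q @^-1` [set z]) < +oo)%E.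
  move=> z0; apply: le_lt_trans (fs _ z0); apply: le_measure; rewrite ?inE; [exact: mDpre..|].
  by move=> x [Dx /= <-].
have snd_fin z : z.2 != 0 -> (mu (D `&` q @^-1` [set z]) < +oo)%E.
  move=> z0; apply: le_lt_trans (fs' _ z0); apply: le_measure; rewrite ?inE; [exact: mDpre..|].
  by move=> x [Dx /= <-].
rewrite (simple_integral_comp sq (F := fst) fst_fin).
rewrite (simple_integral_comp sq (F := snd) snd_fin).
rewrite (simple_integral_comp sq (F := fun z => c *: z.1 + z.2)); last first.
  move=> z zn0; have [z10|z10] := eqVneq z.1 0; last exact: fst_fin.
  by apply: snd_fin; move: zn0; rewrite z10 scaler0 add0r.
rewrite !fsbig_finite// scaler_sumr -big_split/=; apply: eq_bigr => z _.
by rewrite scalerDr !scalerA mulrC.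
Qed.

Lemma integral_norm_simple (s : T -> X) : simple_fun s ->
  (\int[mu]_(x in D) (`|s x|)%:E =
   \sum_(v \in range s) (`|v|)%:E * mu (D `&` s @^-1` [set v]))%E.
Proof.
move=> ss; have [fs ms] := ss.
transitivity (\int[mu]_(x in D)
    (\sum_(v \in range s) (`|v| * \1_(s @^-1` [set v]) x)%:E))%E.
  apply: eq_integral => x _; rewrite (fsbigD1 (s x))//=; last by exists x.
  rewrite indicE mem_set// mulr1 fsbig1 ?adde0// => v [_ /= vs].
  by rewrite indicE memNset ?mulr0// => /= sv; exact: vs.
rewrite ge0_integral_fsum//.
- apply: eq_fsbigr => v _; under eq_integral do rewrite EFinM.
  rewrite ge0_integralZl_EFin//; last exact/measurable_EFinP/measurable_indic.
  by rewrite integral_indic// setIC.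
- move=> v; apply/measurable_EFinP; exact: measurable_funM.
Qed.

Lemma le_norm_simple_integral (s : T -> X) : simple_integrable mu D s ->
  ((`|simple_integral mu D s|)%:E <= \int[mu]_(x in D) (`|s x|)%:E)%E.
Proof.
move=> [ss fs]; rewrite integral_norm_simple//; have [fins _] := ss.
rewrite /simple_integral !fsbig_finite//.
apply: (@le_trans _ _ (_%:E)); first by rewrite lee_fin; exact: ler_norm_sum.
rewrite -sumEFin; apply: lee_sum => v _.
have [->|v0] := eqVneq v 0; first by rewrite scaler0 normr0 mul0e.
rewrite normrZ ger0_norm ?fine_ge0// mulrC EFinM fineK// ge0_fin_numE//.
exact: fs.
Qed.

End simple_integral.

(** Convergence at every point, unlike in [bochner_measurable]: the norm is then measurable for the
    given sigma-algebra, as Tonelli and dominated convergence require. *)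
Definition strongly_measurable d (T : measurableType d) (R : realType)
    (X : completeNormedModType R) (f : T -> X) : Prop :=
  exists2 s : nat -> T -> X, (forall n, simple_fun (s n)) &
    forall x, s n x @[n --> \oo] --> f x.

Section strongly_measurable.
Context d (T : measurableType d) (R : realType) (X : completeNormedModType R).
Implicit Types f g : T -> X.
Import HBNNSimple.

Lemma strongly_measurable_norm f :
  strongly_measurable f -> measurable_fun [set: T] (fun x => `|f x|).
Proof.
move=> [s ss sf]; apply: (measurable_fun_cvg (h := fun n x => `|s n x|)).
  by move=> n; exact: (simple_fun_measurable (fun v : X => `|v|) (ss n)).
by move=> x _; apply: cvg_norm; exact: sf.
Qed.

Lemma simple_strongly_measurable f : simple_fun f -> strongly_measurable f.
Proof. by move=> sf; exists (fun=> f) => // x; exact: cvg_cst. Qed.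

Lemma strongly_measurable_cst (c : X) : strongly_measurable (fun _ : T => c).
Proof.
exact/simple_strongly_measurable/simple_fun_cst.
Qed.

Lemma strongly_measurable_lin (c : R) f g :
  strongly_measurable f -> strongly_measurable g ->
  strongly_measurable (fun x => c *: f x + g x).
Proof.
move=> [s ss sf] [s' ss' sg]; exists (fun n x => c *: s n x + s' n x).
  move=> n.
  exact: (simple_fun_comp (fun z => c *: z.1 + z.2) (simple_fun_pair (ss n) (ss' n))).
by move=> x; apply: cvgD => //; apply: cvgZr; exact: sf.
Qed.

Lemma strongly_measurableB f g :
  strongly_measurable f -> strongly_measurable g ->
  strongly_measurable (fun x => f x - g x).
Proof.
move=> mf mg; rewrite (_ : (fun x => _) = (fun x => (-1) *: g x + f x)).
  exact: strongly_measurable_lin.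
by apply/funext => x; rewrite scaleN1r addrC.
Qed.

Lemma strongly_measurableZ (k : T -> R) f :
  measurable_fun [set: T] k -> (forall x, 0 <= k x) ->
  strongly_measurable f -> strongly_measurable (fun x => k x *: f x).
Proof.
move=> mk k0 [s ss sf].
have mk' : measurable_fun [set: T] (EFin \o k) by exact/measurable_EFinP.
pose h := nnsfun_approx measurableT mk'.
exists (fun n x => h n x *: s n x).
  move=> n; have sh : simple_fun (h n) by split=> // v; exact: measurable_sfunP.
  exact: (simple_fun_comp (fun z => z.1 *: z.2) (simple_fun_pair sh (ss n))).
move=> x; apply: cvgZ; last exact: sf.
rewrite (_ : (fun n => _) = fine \o (EFin \o h^~ x))//; apply: fine_cvg.
by apply: cvg_nnsfun_approx => // y _; rewrite lee_fin.
Qed.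

Lemma strongly_measurable_restrict (A : set T) f : measurable A ->
  strongly_measurable f -> strongly_measurable (fun x => \1_A x *: f x).
Proof.
move=> mA; apply: strongly_measurableZ => //; exact: measurable_indic.
Qed.

End strongly_measurable.

Section bochner.
Context d (T : measurableType d) (R : realType) (X : completeNormedModType R).
Variables (mu : {measure set T -> \bar R}) (D : set T).
Hypothesis mD : measurable D.
Implicit Types f g : T -> X.

(** The approximations are set to 0 off [D] and on a measurable null set containing the bad points,
    so they converge everywhere. *)
Lemma bochner_measurable_rep f : bochner_measurable mu D f ->
  exists g, [/\ strongly_measurable g, (forall x, ~ D x -> g x = 0) &
                {ae mu, forall x, D x -> f x = g x}].
Proof.
move=> [s ss [N [mN N0 sN]]].
pose E := D `\` N; have mE : measurable E by exact: measurableD.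
pose cut (h : T -> X) x := if x \in E then h x else 0.
exists (cut f); split.
- exists (fun n => cut (s n)) => [n|x].
    exact: (simple_fun_comp (fun z => if z.1 then z.2 else 0)
             (simple_fun_pair (simple_fun_mem mE) (ss n))).
  rewrite /cut; case: ifPn => [/set_mem[Dx Nx]|_]; last exact: cvg_cst.
  by apply: contrapT => nc; apply/Nx/sN => /(_ Dx).
- by move=> x Dx; rewrite /cut memNset// => -[].
- exists N; split=> // x /= /not_implyP[Dx fx]; apply: contrapT => Nx; apply: fx.
  by rewrite /cut mem_set.
Qed.

Let measurable_dist f g : strongly_measurable f -> strongly_measurable g ->
  measurable_fun D (fun x => (`|f x - g x|)%:E).
Proof.
move=> mf mg; apply/measurable_EFinP; apply: measurable_funTS.
exact/strongly_measurable_norm/strongly_measurableB.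
Qed.

Lemma bochner_approx_exists f : strongly_measurable f ->
  (\int[mu]_(x in D) (`|f x|)%:E < +oo)%E -> bochner_integrable mu D f.
Proof.
move=> mf intf; have [s ss sf] := mf.
have mnf := strongly_measurable_norm mf.
(* Discarding the values of norm above [2 |f|] makes the sequence dominated. *)
pose E n := [set x | `|s n x| <= 2 * `|f x|].
have mE n : measurable (E n).
  have mb : measurable_fun setT (fun x => `|s n x| <= 2 * `|f x|).
    apply: measurable_fun_ler; last exact: measurable_funM.
    exact: (simple_fun_measurable (fun v : X => `|v|) (ss n)).
  by have := mb measurableT [set true] I; rewrite setTI.
pose u n x := if x \in E n then s n x else 0.
have su n : simple_fun (u n).
  exact: (simple_fun_comp (fun z => if z.1 then z.2 else 0)
           (simple_fun_pair (simple_fun_mem (mE n)) (ss n))).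
(* Where [f x = 0] the cut forces the value 0; elsewhere [|s n x| < 2 |f x|] eventually and nothing
   is discarded. *)
have uf x : u n x @[n --> \oo] --> f x.
  have [fx0|fx0] := eqVneq (f x) 0.
    rewrite fx0 (_ : (fun n => _) = (fun=> 0)); first exact: cvg_cst.
    apply/funext => n; rewrite /u; case: ifPn => // /set_mem; rewrite /E/=.
    by rewrite fx0 normr0 mulr0 normr_le0 => /eqP.
  apply: cvg_trans (sf x); apply: near_eq_cvg; near=> n.
  rewrite /u mem_set// /E/=; apply/ltW; near: n.
  apply: (cvgr_lt `|f x|); first by apply: cvg_norm; exact: sf.
  by rewrite ltr_pMl ?ltr1n// normr_gt0.
have ule n x : `|u n x| <= 2 * `|f x|.
  rewrite /u; case: ifPn => [/set_mem//|_].
  by rewrite normr0 mulr_ge0.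
exists u; split.
- move=> n; split=> // v v0.
  (* On the level set of [v] one has [|f| >= |v| / 2], so an infinite measure would contradict the
     integrability of [|f|]. *)
  rewrite ltNge leye_eq; apply/eqP => muy.
  have : (\int[mu]_(x in D) ((`|v| / 2)%:E * (\1_(u n @^-1` [set v]) x)%:E)
          <= \int[mu]_(x in D) (`|f x|)%:E)%E.
    apply: le_lower_integral => [x _|x _]; rewrite -EFinM lee_fin.
      by rewrite mulr_ge0// divr_ge0.
    rewrite indicE; case: (boolP (x \in _)) => [/set_mem /= uv|_]; last by rewrite mulr0.
    by rewrite mulr1 -uv ler_pdivrMr// mulrC.
  rewrite ge0_integralZl_EFin//; last first.
    exact/measurable_EFinP/measurable_indic/simple_fun_preimage.
  rewrite integral_indic//; last exact: simple_fun_preimage.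
  rewrite setIC muy gt0_muley ?lte_fin ?divr_gt0 ?normr_gt0//.
  by rewrite leye_eq => /eqP fy; rewrite fy in intf.
- exact: aeW.
- have if3 : mu.-integrable D (fun x => (3%:E * (`|f x|)%:E)%E).
    apply: integrableZl => //; apply/integrableP; split.
      by apply/measurable_EFinP; exact: measurable_funTS.
    by under eq_integral do rewrite /= normr_id.
  have := @dominated_convergence _ T R mu D mD
    (fun n x => (`|f x - u n x|)%:E) (cst 0%E) _ _ _ _ if3 _.
  case=> //.
  + by move=> n; apply: measurable_dist => //; exact: simple_strongly_measurable.
  + apply: aeW => x Dx /=; apply: cvg_EFin; first exact: nearW.
    rewrite -(normr0 X) -(subrr (f x)); apply: cvg_norm; apply: cvgB => //.
    exact: cvg_cst.
  + apply: aeW => x n Dx /=; rewrite normr_id -EFinM lee_fin.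
    apply: le_trans (ler_normB _ _) _; rewrite -nat1r mulrDl mul1r.
    by rewrite lerD2l.
  + by rewrite integral0.
Unshelve. all: by end_near. Qed.

End bochner.

Section bochner_integral.
Context d (T : measurableType d) (R : realType) (X : completeNormedModType R).
Variables (mu : {measure set T -> \bar R}).
Implicit Types (D : set T) (f g : T -> X).

Let measurable_dist D f g : strongly_measurable f -> strongly_measurable g ->
  measurable_fun D (fun x => (`|f x - g x|)%:E).
Proof.
move=> mf mg; apply/measurable_EFinP; apply: measurable_funTS.
exact/strongly_measurable_norm/strongly_measurableB.
Qed.

(** Equality as predicates makes the [xget] in [bochner_integral] choose the same value for both
    functions, also when neither is integrable. *)
Lemma ae_eq_bochner_approx D f g :
  {ae mu, forall x, D x -> f x = g x} ->
  bochner_approx mu D f = bochner_approx mu D g.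
Proof.
move=> fg; apply/funext => s; apply/propext.
suff sub f1 g1 : {ae mu, forall x, D x -> f1 x = g1 x} ->
    bochner_approx mu D f1 s -> bochner_approx mu D g1 s.
  split; apply: sub => //; apply: filterS fg => x + Dx => /(_ Dx)//.
move=> {fg}fg [is1 sf1 is0]; split=> //.
  by apply: filterS2 fg sf1 => x fg sf Dx; rewrite -fg//; exact: sf.
apply: cvg_trans is0; apply: near_eq_cvg; apply: nearW => n.
apply: ae_eq_lower_integral => //.
by apply: filterS fg => x fg Dx; rewrite fg.
Qed.

Lemma ae_eq_bochner_integral D f g : {ae mu, forall x, D x -> f x = g x} ->
  bochner_integral mu D f = bochner_integral mu D g.
Proof. by move=> fg; rewrite /bochner_integral (ae_eq_bochner_approx fg). Qed.

Lemma ae_bochner_integrable D f g : {ae mu, forall x, D x -> f x = g x} ->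
  bochner_integrable mu D f -> bochner_integrable mu D g.
Proof. by move=> fg; rewrite /bochner_integrable (ae_eq_bochner_approx fg). Qed.

(** With [g = f] this yields both the Cauchy property and the independence of the limit from the
    sequence; with [g = 0] it yields the norm inequality. *)
Lemma bochner_approx_dist D f g s t n m : measurable D ->
  strongly_measurable f -> strongly_measurable g ->
  bochner_approx mu D f s -> bochner_approx mu D g t ->
  ((`|simple_integral mu D (s n) - simple_integral mu D (t m)|)%:E <=
   \int[mu]_(x in D) (`|f x - g x|)%:E +
   (\int[mu]_(x in D) (`|f x - s n x|)%:E + \int[mu]_(x in D) (`|g x - t m x|)%:E))%E.
Proof.
move=> mD mf mg [is_ _ _] [it _ _].
have ms k : strongly_measurable (s k) by apply: simple_strongly_measurable; case: (is_ k).
have mt k : strongly_measurable (t k) by apply: simple_strongly_measurable; case: (it k).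
rewrite addrC -scaleN1r -simple_integral_lin//.
apply: le_trans.
  by apply: le_norm_simple_integral => //; exact: simple_integrable_lin.
rewrite -ge0_integralD//; try exact: measurable_dist.
rewrite -ge0_integralD//; try exact: measurable_dist; first last.
  by apply: emeasurable_funD; exact: measurable_dist.
  by move=> x _; rewrite adde_ge0.
apply: le_lower_integral => x _; rewrite -?EFinD lee_fin//.
rewrite scaleN1r (_ : - t m x + s n x = (f x - g x) + ((s n x - f x) + (g x - t m x))).
  apply: le_trans (ler_normD _ _) _; rewrite lerD2l.
  by apply: le_trans (ler_normD _ _) _; rewrite (distrC (s n x)).
by rewrite [f x - g x]addrC -[RHS]addrA [f x + _]addrA [f x + _]addrC subrK addrCA addKr addrC.
Qed.

(** Completeness of [X] gives [s] a limit, so [xget] picks a genuine value, attained along some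
    sequence [t]; the integrals of [s] and [t] differ by a null sequence. *)
Lemma bochner_integral_cvg D f s : measurable D -> strongly_measurable f ->
  bochner_approx mu D f s ->
  simple_integral mu D (s n) @[n --> \oo] --> bochner_integral mu D f.
Proof.
move=> mD mf fs.
have ff0 : (\int[mu]_(x in D) (`|f x - f x|)%:E = 0)%E.
  by apply: integral0_eq => x _; rewrite subrr normr0.
have dist0 t : bochner_approx mu D f t -> forall e : R, 0 < e ->
    exists N, forall n m, (N <= n)%N -> (N <= m)%N ->
    `|simple_integral mu D (s n) - simple_integral mu D (t m)| < e.
  move=> ft e e0.
  have small u : bochner_approx mu D f u -> exists N, forall n, (N <= n)%N ->
      (\int[mu]_(x in D) (`|f x - u n x|)%:E < (e / 2)%:E)%E.
    move=> [_ _ u0].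
    have : \forall n \near \oo, (\int[mu]_(x in D) (`|f x - u n x|)%:E < (e / 2)%:E)%E.
      have e20 : (0 < (e / 2)%:E)%E by rewrite lte_fin divr_gt0.
      exact: (u0 _ (open_ereal_lt' e20)).
    by case=> N _ hN; exists N => n; exact: hN.
  have [N1 hN1] := small _ fs; have [N2 hN2] := small _ ft.
  exists (maxn N1 N2) => n m; rewrite !geq_max => /andP[n1 _] /andP[_ m2].
  rewrite -lte_fin; apply: le_lt_trans (bochner_approx_dist n m mD mf mf fs ft) _.
  rewrite ff0 add0e [e]splitr EFinD; apply: lteD; [exact: hN1|exact: hN2].
have cs : cvgn (fun n => simple_integral mu D (s n)).
  apply/cauchy_cvgP/cauchy_exP => e e0; have [N hN] := dist0 s fs e e0.
  exists (simple_integral mu D (s N)); exists N => // n /= Nn.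
  by rewrite -ball_normE; exact: hN.
have [t ft tv] : exists2 t, bochner_approx mu D f t &
    simple_integral mu D (t n) @[n --> \oo] --> bochner_integral mu D f.
  rewrite /bochner_integral.
  have := @xgetI X 0 [set v | exists2 s0, bochner_approx mu D f s0 &
    simple_integral mu D (s0 n) @[n --> \oo] --> v]
    (limn (fun n => simple_integral mu D (s n))).
  by apply; exists s.
rewrite -[bochner_integral _ _ _]addr0.
rewrite (_ : (fun n => _) = (fun n => simple_integral mu D (t n) +
   (simple_integral mu D (s n) - simple_integral mu D (t n)))); last first.
  by apply/funext => n; rewrite addrC subrK.
apply: cvgD => //; apply/cvgr0Pnorm_lt => e e0.
by have [N hN] := dist0 t ft e e0; exists N => // n /= Nn; exact: hN.
Qed.

(** Integrability is not assumed: if the right side is infinite, the bound holds whatever default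
    the left side takes. *)
Lemma le_norm_bochner_integral D f : measurable D -> strongly_measurable f ->
  ((`|bochner_integral mu D f|)%:E <= \int[mu]_(x in D) (`|f x|)%:E)%E.
Proof.
move=> mD mf; have [intf|] := boolP ((\int[mu]_(x in D) (`|f x|)%:E < +oo)%E); last first.
  by rewrite -leNgt leye_eq => /eqP ->; rewrite leey.
have [s fs] := bochner_approx_exists mD mf intf.
have If := bochner_integral_cvg mD mf fs.
have m0 := @strongly_measurable_cst d T R X 0.
have app0 : bochner_approx mu D (fun=> 0 : X) (fun=> fun=> 0).
  split=> [n||].
  - split=> [|v v0]; first exact: simple_fun_cst.
    by rewrite preimage_cst memNset ?setI0 ?measure0// => /= v00; rewrite v00 eqxx in v0.
  - by apply: aeW => x _; exact: cvg_cst.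
  - rewrite (_ : (fun n => _) = fun=> 0%E); first exact: cvg_cst.
    by apply/funext => n; apply: integral0_eq => x _; rewrite subrr normr0.
have SI0 : simple_integral mu D (fun=> 0 : X) = 0.
  rewrite /simple_integral fsbig1// => v [x _ <-]; exact: scaler0.
have le n : ((`|simple_integral mu D (s n)|)%:E <=
    \int[mu]_(x in D) (`|f x|)%:E + \int[mu]_(x in D) (`|f x - s n x|)%:E)%E.
  have := bochner_approx_dist n 0 mD mf m0 fs app0.
  rewrite SI0 subr0; under [X in (_ <= X + _)%E]eq_integral do rewrite subr0.
  rewrite (_ : (\int[mu]_(x in D) (`|0 - 0 : X|)%:E)%E = 0%E) ?adde0//.
  by apply: integral0_eq => x _; rewrite subrr normr0.
rewrite -[leRHS]adde0.
apply: (lee_cvg_to (T := nat) (a := \oo) (f := fun n => (`|simple_integral mu D (s n)|)%:E)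
  (g := fun n => \int[mu]_(x in D) (`|f x|)%:E + \int[mu]_(x in D) (`|f x - s n x|)%:E)%E).
- apply: cvg_EFin; first exact: nearW.
  exact: cvg_norm If.
- apply: cvgeD; [|exact: cvg_cst|by case: fs].
  exact: fin_num_adde_defl.
- exact: nearW.
Qed.

Lemma bochner_integral_lin D (c : R) f g : measurable D ->
  strongly_measurable f -> strongly_measurable g ->
  (\int[mu]_(x in D) (`|f x|)%:E < +oo)%E ->
  (\int[mu]_(x in D) (`|g x|)%:E < +oo)%E ->
  bochner_integral mu D (fun x => c *: f x + g x) =
  c *: bochner_integral mu D f + bochner_integral mu D g.
Proof.
move=> mD mf mg intf intg.
have [s fs] := bochner_approx_exists mD mf intf.
have [t gt_] := bochner_approx_exists mD mg intg.
have mfg := strongly_measurable_lin c mf mg.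
have fgst : bochner_approx mu D (fun x => c *: f x + g x)
    (fun n x => c *: s n x + t n x).
  have [is_ sf s0] := fs; have [it tg t0] := gt_.
  split.
  - by move=> n; exact: simple_integrable_lin.
  - apply: filterS2 sf tg => x sf tg Dx; apply: cvgD; last exact: tg.
    by apply: cvgZr; exact: sf.
  - apply: (@squeeze_cvge _ _ _ _ (cst 0%E) _ (fun n =>
      (`|c|)%:E * \int[mu]_(x in D) (`|f x - s n x|)%:E
       + \int[mu]_(x in D) (`|g x - t n x|)%:E)%E).
    + apply: nearW => n; apply/andP; split.
        by apply: integral_ge0 => x _; rewrite lee_fin.
      have ms k : strongly_measurable (s k).
        by apply: simple_strongly_measurable; case: (is_ k).
      have mt k : strongly_measurable (t k).
        by apply: simple_strongly_measurable; case: (it k).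
      rewrite -ge0_integralZl_EFin//; last exact: measurable_dist.
      rewrite -ge0_integralD//; last 2 first.
      * by apply: measurable_funeM; exact: measurable_dist.
      * exact: measurable_dist.
      apply: le_lower_integral => x _; rewrite -?EFinM -?EFinD lee_fin//.
      rewrite -normrZ scalerBr opprD addrACA.
      exact: ler_normD.
    + exact: cvg_cst.
    + have := cvgeD _ (cvgeZl (y := (`|c|)%:E) isT s0) t0.
      by rewrite mule0 add0e; exact.
have := bochner_integral_cvg mD mfg fgst.
rewrite (_ : (fun n => _) = (fun n => c *: simple_integral mu D (s n) +
    simple_integral mu D (t n))); last first.
  by apply/funext => n; rewrite simple_integral_lin//; [case: fs|case: gt_].
move=> h; apply: cvg_unique h _; first exact: norm_hausdorff.
apply: cvgD; last exact: bochner_integral_cvg.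
by apply: cvgZr; exact: bochner_integral_cvg.
Qed.

(** Cutting the approximations to [D] changes only their level set at 0, which contributes nothing.
    This turns the moving domain [[t0, t]] into the whole line. *)
Lemma bochner_integral_mkcond D f : measurable D -> strongly_measurable f ->
  (\int[mu]_(x in D) (`|f x|)%:E < +oo)%E ->
  bochner_integral mu D f = bochner_integral mu [set: T] (fun x => \1_D x *: f x).
Proof.
move=> mD mf intf.
have [s fs] := bochner_approx_exists mD mf intf.
have [is_ sf s0] := fs.
pose s' n x := \1_D x *: s n x.
have pre n v : v != 0 -> [set: T] `&` s' n @^-1` [set v] = D `&` s n @^-1` [set v].
  move=> v0; apply/seteqP; split=> [x [_]|x [Dx]]; rewrite /s' /= indicE.
    have [Dx|Dx] := boolP (x \in D).
      by rewrite scale1r => ->; split=> //; exact: set_mem.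
    by rewrite scale0r => v00; rewrite -v00 eqxx in v0.
  by rewrite mem_set// scale1r.
have ss' n : simple_fun (s' n).
  have [ssn _] := is_ n.
  exact: (simple_fun_comp (fun z : bool * X => (z.1%:R : R) *: z.2)
    (simple_fun_pair (simple_fun_mem mD) ssn)).
have app' : bochner_approx mu setT (fun x => \1_D x *: f x) s'.
  split.
  - move=> n; split=> // v v0; rewrite pre//; by case: (is_ n) => _; exact.
  - apply: filterS sf => x sfx _; rewrite /s' indicE.
    have [/set_mem Dx|Dx] := boolP (x \in D); first by apply: cvgZr; exact: sfx.
    by under eq_fun do rewrite scale0r; rewrite scale0r; exact: cvg_cst.
  - rewrite (_ : (fun n => _) = (fun n => \int[mu]_(x in D) (`|f x - s n x|)%:E)%E)//.
    apply/funext => n; rewrite [RHS]integral_mkcond; apply: eq_integral => x _.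
    rewrite /s' -scalerBr patchE indicE.
    by case: ifPn => _; rewrite ?scale1r// scale0r normr0.
have mf' := strongly_measurable_restrict mD mf.
have := bochner_integral_cvg measurableT mf' app'.
rewrite (_ : (fun n => _) = (fun n => simple_integral mu D (s n))).
  apply: cvg_unique; first exact: norm_hausdorff.
  exact: bochner_integral_cvg.
apply/funext => n; rewrite /simple_integral.
have fin1 : finite_set (range (s n)) by case: (is_ n) => -[].
have fin2 : finite_set (range (s' n)) by case: (ss' n).
pose F1 v := fine (mu ([set: T] `&` s' n @^-1` [set v])) *: v.
pose F2 v := fine (mu (D `&` s n @^-1` [set v])) *: v.
have E v : v != 0 -> F1 v = F2 v by move=> v0; rewrite /F1 /F2 pre.
have F10 v (u : T -> X) : ~ range u v -> u @^-1` [set v] = set0.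
  by move=> uv; apply/seteqP; split=> // x /= ux; apply: uv; exists x.
(* The two ranges can differ by 0 and by values taken only off [D]; both sums are extended to the
   union, where the added terms vanish. *)
transitivity (\sum_(v \in range (s n) `|` range (s' n)) F1 v).
  rewrite -/F1; apply: fsbig_widen => [x|v [_ /= nv]]; first by right.
  by rewrite /F1 F10// setI0 measure0 scale0r.
transitivity (\sum_(v \in range (s n) `|` range (s' n)) F2 v).
  apply: eq_fsbigr => v _; have [->|/E//] := eqVneq v 0.
  by rewrite /F1 /F2 !scaler0.
apply/esym; apply: fsbig_widen => [x|v [_ /= nv]]; first by left.
by rewrite /F2 F10// setI0 measure0 scale0r.
Qed.

Lemma bochner_integral_cst D (c : X) : measurable D -> (mu D < +oo)%E ->
  bochner_integral mu D (fun=> c) = fine (mu D) *: c.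
Proof.
move=> mD fD.
have mc := @strongly_measurable_cst d T R X c.
have app : bochner_approx mu D (fun=> c) (fun=> fun=> c).
  split=> [n||].
  - split=> [|v v0]; first exact: simple_fun_cst.
    by rewrite preimage_cst; case: ifPn => _; rewrite ?setIT// setI0 measure0.
  - by apply: aeW => x _; exact: cvg_cst.
  - rewrite (_ : (fun n => _) = fun=> 0%E); first exact: cvg_cst.
    by apply/funext => n; apply: integral0_eq => x _; rewrite subrr normr0.
have := bochner_integral_cvg mD mc app => h.
apply: cvg_unique h _; first exact: norm_hausdorff.
rewrite (_ : simple_integral _ _ _ = fine (mu D) *: c); first exact: cvg_cst.
rewrite /simple_integral.
transitivity (\sum_(v \in [set c]) fine (mu D) *: v); last by rewrite fsbig_set1.
transitivity (\sum_(v \in range (fun _ : T => c)) fine (mu D) *: v).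
  by apply: eq_fsbigr => v /set_mem[x _ <-]; rewrite preimage_cst mem_set// setIT.
apply: fsbig_widen => [_ [x _ <-]//|v [/= ->] /= nr].
suff -> : D = set0 by rewrite measure0 scale0r.
by apply/seteqP; split=> // x _; apply: nr; exists x.
Qed.

End bochner_integral.

(** ** Fractional kernels *)

Section hoelder_le.
Context d (T : measurableType d) (R : realType) (mu : {measure set T -> \bar R}).

(** Bounds on integrals of powers replace norms, so that one application can supply a hypothesis of
    another. *)
Lemma hoelder_le (D : set T) (f g : T -> R) (p q a b : R) : measurable D ->
  measurable_fun [set: T] f -> measurable_fun [set: T] g ->
  (forall x, 0 <= f x) -> (forall x, 0 <= g x) ->
  0 < p -> 0 < q -> p^-1 + q^-1 = 1 -> 0 <= a -> 0 <= b ->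
  (\int[mu]_(x in D) (f x `^ p)%:E <= (a `^ p)%:E)%E ->
  (\int[mu]_(x in D) (g x `^ q)%:E <= (b `^ q)%:E)%E ->
  (\int[mu]_(x in D) (f x * g x)%:E <= (a * b)%:E)%E.
Proof.
move=> mD mf mg f0 g0 p0 q0 pq a0 b0 fa gb.
pose f' x := \1_D x * f x; pose g' x := \1_D x * g x.
have mf' : measurable_fun [set: T] f' by apply: measurable_funM.
have mg' : measurable_fun [set: T] g' by apply: measurable_funM.
have Lr (u : T -> R) (s c : R) : (forall x, 0 <= u x) -> 0 < s -> 0 <= c ->
    (\int[mu]_(x in D) (u x `^ s)%:E <= (c `^ s)%:E)%E ->
    ('N[mu]_s%:E[EFin \o (fun x => \1_D x * u x)%R] <= c%:E)%E.
  move=> u0 s0 c0 uc; rewrite unlock /Lnorm.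
  rewrite (_ : (\int[mu]_x _)%E = (\int[mu]_(x in D) (u x `^ s)%:E)%E); last first.
    rewrite [RHS]integral_mkcond; apply: eq_integral => x _.
    rewrite /= patchE indicE; case: ifPn => _.
      by rewrite mul1r ger0_norm.
    by rewrite mul0r normr0 powR0 ?gt_eqF.
  rewrite -[leRHS]poweRe1 ?lee_fin// -(mulfV (lt0r_neq0 s0)) poweRrM.
  rewrite gt0_ler_poweR ?invr_ge0 ?(ltW s0)//.
  - by rewrite in_itv/= leey andbT; apply: integral_ge0 => x _; rewrite lee_fin powR_ge0.
  - by rewrite in_itv/= leey andbT lee_fin powR_ge0.
have := hoelder mu mf' mg' p0 q0 pq.
rewrite Lnorm1 (_ : (\int[mu]_x _)%E = (\int[mu]_(x in D) (f x * g x)%:E)%E); last first.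
  rewrite [RHS]integral_mkcond; apply: eq_integral => x _.
  rewrite /= patchE /f' /g' indicE; case: ifPn => _.
    by rewrite !mul1r ger0_norm// mulr_ge0.
  by rewrite !mul0r normr0.
move/le_trans; apply; rewrite EFinM; apply: lee_pmul; rewrite ?Lnorm_ge0//.
- exact: Lr.
- exact: Lr.
Qed.

End hoelder_le.

Section improper.
Context (R : realType).
Notation mu := (@lebesgue_measure R).

(** An improper form for singular kernels: nothing is asked at the endpoints, only a bound on the
    increments of [F] inside. Compact subintervals exhaust the open one, and monotone convergence
    concludes. *)
Lemma FTC_le (f F : R -> R) (a b M : R) : a < b ->
  (forall x, a < x < b -> 0 <= f x) ->
  (forall x, a < x < b -> derivable f x 1) ->
  (forall x, a < x < b -> is_derive x 1 F (f x)) ->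
  (forall x y, a < x -> x < y -> y < b -> F y - F x <= M) ->
  (\int[mu]_(x in `]a, b[) (f x)%:E <= M%:E)%E.
Proof.
move=> ab f0 df dF FM.
(* The denominator is at least 3, so [[a + e n, b - e n]] is nondegenerate already for [n = 0]. *)
pose e n : R := (b - a) / n.+3%:R.
have e0 n : 0 < e n by rewrite divr_gt0 ?subr_gt0.
have e3 n : 3 * e n <= b - a.
  rewrite /e mulrCA ger_pMr ?subr_gt0// ler_pdivrMr// mul1r ler_nat.
  by [].
pose G n := `[a + e n, b - e n]%classic.
have Gsub n x : G n x -> a < x < b.
  by rewrite /G/= in_itv/= => /andP[h1 h2]; have := e0 n; lra.
have mono : nondecreasing_seq G.
  move=> n m nm; apply/subsetPset => x; rewrite /G/= !in_itv/= => /andP[h1 h2].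
  have : e m <= e n.
    by rewrite /e ler_pM2l ?subr_gt0// lef_pV2 ?posrE// ler_nat.
  by move=> emn; apply/andP; split; lra.
have cup : \bigcup_n G n = `]a, b[%classic.
  apply/seteqP; split=> [x [n _ /Gsub]|x]; first by rewrite /= in_itv.
  rewrite /= in_itv/= => /andP[ax xb].
  pose c := Num.min (x - a) (b - x).
  have c0 : 0 < c by rewrite lt_min !subr_gt0 ax xb.
  pose n := Num.truncn ((b - a) / c).
  have en : e n <= c.
    rewrite /e ler_pdivrMr// mulrC -ler_pdivrMr//; apply: ltW.
    have h : 0 <= (b - a) / c by rewrite divr_ge0 ?ltW// subr_gt0.
    have /andP[_ /lt_le_trans] := truncn_itv h; apply.
    by rewrite ler_nat -addn3 -addn1 leq_add2l.
  exists n => //; rewrite /G/= in_itv/=.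
  have : c <= x - a /\ c <= b - x by rewrite /c !ge_min !lexx orbT.
  by move=> [c1 c2]; apply/andP; split; lra.
have mG n : measurable (G n) by exact: measurable_itv.
have cG n : {within G n, continuous f}.
  apply: derivable_within_continuous => x xG.
  by apply: df; apply: (Gsub n).
have mf n : measurable_fun (G n) (EFin \o f).
  apply/measurable_EFinP; apply: subspace_continuous_measurable_fun => //.
have lim : (\int[mu]_(x in G n) (f x)%:E)%E @[n --> \oo] -->
    (\int[mu]_(x in \bigcup_n G n) (f x)%:E)%E.
  apply: ge0_nondecreasing_set_cvg_integral => // n x /Gsub xab.
  by rewrite lee_fin f0.
rewrite -cup; apply: (cvge_to_le lim).
apply: nearW => n.
have lt : a + e n < b - e n by have := e0 n; have := e3 n; lra.
have contF x : a < x < b -> {for x, continuous F}.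
  move=> xab; apply: differentiable_continuous; apply/derivable1_diffP.
  by have [] := dF x xab.
have Gn x : a + e n <= x -> x <= b - e n -> a < x < b.
  by move=> h1 h2; apply: (Gsub n); rewrite /G/= in_itv/= h1.
rewrite (@continuous_FTC2 R f F)//.
- rewrite -EFinB lee_fin; apply: FM => //; have := e0 n; have := e3 n; lra.
- exact: cG.
- split.
  + move=> x; rewrite in_itv/= => /andP[h1 h2].
    by have [] := dF x (Gn x (ltW h1) (ltW h2)).
  + by apply: cvg_at_right_filter; apply: contF; apply: Gn => //; exact: ltW.
  + by apply: cvg_at_left_filter; apply: contF; apply: Gn => //; exact: ltW.
- move=> x; rewrite in_itv/= => /andP[h1 h2]; rewrite derive1E.
  by have [_ ->] := dF x (Gn x (ltW h1) (ltW h2)).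
Qed.

End improper.

(* Unlike [u `^ (- b)], which is [1] for [u < 0], this vanishes for [u <= 0]. *)
Definition kern (R : realType) (b u : R) : R := if 0 < u then u `^ (- b) else 0.

Section kern.
Context (R : realType).
Notation mu := (@lebesgue_measure R).
Implicit Types a b c s t u x : R.

Lemma kern_ge0 b u : 0 <= kern b u.
Proof. by rewrite /kern; case: ifP => // _; exact: powR_ge0. Qed.

Lemma kern_gt0 b u : 0 < u -> kern b u = u `^ (- b).
Proof. by rewrite /kern => ->. Qed.

Lemma kern_le0 b u : u <= 0 -> kern b u = 0.
Proof. by rewrite /kern leNgt => /negbTE ->. Qed.

Lemma measurable_kern b : measurable_fun [set: R] (kern b).
Proof.
apply: measurable_fun_ifT; first exact: measurable_fun_ltr.
- exact: measurable_powR.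
- exact: measurable_cst.
Qed.

Lemma kern_powR b c u : c != 0 -> kern b u `^ c = kern (b * c) u.
Proof.
move=> c0; rewrite /kern; case: ifPn => _; last by rewrite powR0.
by rewrite -powRrM mulNr.
Qed.

Lemma is_derive_powRl c t x : x < t ->
  is_derive x 1 (fun s => (t - s) `^ c) (- (c * (t - x) `^ (c - 1))).
Proof.
move=> xt; have tx0 : 0 < t - x by rewrite subr_gt0.
have h1 : is_derive x 1 (fun s => t - s) (-1).
  by apply: is_derive_eq; rewrite add0r mul1r.
have h2 := is_derive1_powR c tx0.
have := @is_derive1_comp R (fun u => u `^ c) (fun s => t - s) x _ _ h2 h1.
by rewrite mulrN1.
Qed.

Lemma is_derive_powRr c s x : s < x ->
  is_derive x 1 (fun t => (t - s) `^ c) (c * (x - s) `^ (c - 1)).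
Proof.
move=> sx; have xs0 : 0 < x - s by rewrite subr_gt0.
have h1 : is_derive x 1 (fun t => t - s) 1.
  by apply: is_derive_eq; ring.
have h2 := is_derive1_powR c xs0.
have := @is_derive1_comp R (fun u => u `^ c) (fun t => t - s) x _ _ h2 h1.
by rewrite mulr1.
Qed.

(** Moves to the open interval on which an antiderivative is known; the endpoints, where the kernels
    are singular or take conventional values, form a null set. *)
Lemma le_integral_oo (D : set R) (f g : R -> R) a b :
  (forall x, 0 <= f x) -> (forall x, a < x < b -> 0 <= g x) ->
  (forall x, D x -> a < x < b -> f x <= g x) ->
  (forall x, D x -> x != a -> x != b -> ~~ (a < x < b) -> f x = 0) ->
  (\int[mu]_(x in D) (f x)%:E <= \int[mu]_(x in `]a, b[) (g x)%:E)%E.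
Proof.
move=> f0 g0 fg fz; rewrite integral_mkcond [leRHS]integral_mkcond.
apply: ae_le_lower_integral => [x _|x _|].
- by apply: erestrict_ge0 => y _; rewrite lee_fin.
- by apply: erestrict_ge0 => y; rewrite /= in_itv/= lee_fin; exact: g0.
- exists ([set a] `|` [set b]); split.
  + by apply: measurableU; exact: measurable_set1.
  + apply/eqP; rewrite eq_le measure_ge0 andbT.
    apply: le_trans (measureU2 _ _ _) _; [exact: measurable_set1..|].
    by rewrite /= !lebesgue_measure_set1 adde0.
  + move=> x /= nh; apply: contrapT => /not_orP[/eqP xa /eqP xb]; apply: nh => _.
    rewrite !patchE; case: ifPn => [/set_mem Dx|_]; last first.
      case: ifPn => // /set_mem; rewrite /= in_itv/= => xab.
      by rewrite lee_fin g0.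
    case: ifPn => [/set_mem|]; rewrite ?notin_setE /= in_itv/=.
      by move=> xab; rewrite lee_fin fg.
    by move=> /negP xab; rewrite fz.
Qed.

Lemma integral_kernl a b t th : a < t -> 0 <= th -> th < 1 ->
  (\int[mu]_(s in `[a, b]) (kern th (t - s))%:E
   <= ((t - a) `^ (1 - th) / (1 - th))%:E)%E.
Proof.
move=> at_ th0 th1; have th10 : 0 < 1 - th by rewrite subr_gt0.
apply: le_trans.
  apply: (@le_integral_oo _ (fun s => kern th (t - s)) (fun s => (t - s) `^ (- th)) a t).
  - by move=> x; exact: kern_ge0.
  - by move=> x _; exact: powR_ge0.
  - by move=> x _ /andP[_ xt]; rewrite kern_gt0// subr_gt0.
  - move=> x; rewrite /= in_itv/= => /andP[ax _] xa xt.
    rewrite lt_neqAle eq_sym xa ax/= -leNgt => tx.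
    by rewrite kern_le0// subr_le0.
apply: (@FTC_le R _ (fun s => - (1 - th)^-1 * (t - s) `^ (1 - th))) => //.
- by move=> x _; exact: powR_ge0.
- by move=> x /andP[_ xt]; have [] := is_derive_powRl (- th) xt.
- move=> x /andP[_ xt]; have h := is_derive_powRl (1 - th) xt.
  have h2 := is_deriveZ (- (1 - th)^-1) h.
  apply: (is_derive_eq h2); rewrite /= /GRing.scale/= mulrN mulNr opprK mulrA mulVf ?gt_eqF// mul1r.
  by congr (_ `^ _); lra.
- move=> x y ax xy yt; rewrite !mulNr opprK addrC -mulrBr mulrC ler_pM2r ?invr_gt0//.
  rewrite lerBlDr; apply: (@le_trans _ _ ((t - a) `^ (1 - th))).
    by apply: ge0_ler_powR; rewrite ?nnegrE; lra.
  by rewrite lerDl powR_ge0.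
Qed.

Lemma integral_kernr a b s th : s < b -> 0 <= th -> th < 1 ->
  (\int[mu]_(t in `[a, b]) (kern th (t - s))%:E
   <= ((b - s) `^ (1 - th) / (1 - th))%:E)%E.
Proof.
move=> sb th0 th1; have th10 : 0 < 1 - th by rewrite subr_gt0.
apply: le_trans.
  apply: (@le_integral_oo _ (fun t => kern th (t - s)) (fun t => (t - s) `^ (- th)) s b).
  - by move=> x; exact: kern_ge0.
  - by move=> x _; exact: powR_ge0.
  - by move=> x _ /andP[sx _]; rewrite kern_gt0// subr_gt0.
  - move=> x; rewrite /= in_itv/= => /andP[_ xb'] xs xb.
    rewrite [x < b]lt_neqAle xb xb'/= andbT -leNgt => xs'.
    by rewrite kern_le0// subr_le0.
apply: (@FTC_le R _ (fun t => (1 - th)^-1 * (t - s) `^ (1 - th))) => //.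
- by move=> x _; exact: powR_ge0.
- by move=> x /andP[sx _]; have [] := is_derive_powRr (- th) sx.
- move=> x /andP[sx _]; have h := is_derive_powRr (1 - th) sx.
  have h2 := is_deriveZ ((1 - th)^-1) h.
  apply: (is_derive_eq h2); rewrite /= /GRing.scale/= mulrA mulVf ?gt_eqF// mul1r.
  by congr (_ `^ _); lra.
- move=> x y sx xy yb; rewrite -mulrBr mulrC ler_pM2r ?invr_gt0//.
  rewrite lerBlDr; apply: (@le_trans _ _ ((b - s) `^ (1 - th))).
    by apply: ge0_ler_powR; rewrite ?nnegrE; lra.
  by rewrite lerDl powR_ge0.
Qed.

Lemma powR_le_add1 c x y : 0 <= c -> c <= 1 -> 0 <= x -> x <= y -> x `^ c <= 1 + y.
Proof.
move=> c0 c1 x0 xy; have [x1|x1] := lerP x 1.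
  apply: (@le_trans _ _ (1 `^ c)); first by apply: ge0_ler_powR => //; rewrite nnegrE.
  by rewrite powR1 lerDl (le_trans x0).
apply: (@le_trans _ _ x); first by apply: ler1_powR => //; exact: ltW.
by rewrite (le_trans xy)// lerDr.
Qed.

End kern.

(** * Tonelli's theorem on measurable rectangles *)

Section tonelli_on.
Context d1 d2 (T1 : measurableType d1) (T2 : measurableType d2) (R : realType).
Variables (m1 : {sigma_finite_measure set T1 -> \bar R})
          (m2 : {sigma_finite_measure set T2 -> \bar R}).
Variables (D : set T1) (E : set T2) (g : T1 * T2 -> R).
Hypotheses (mD : measurable D) (mE : measurable E).
Hypotheses (mg : measurable_fun [set: T1 * T2] g) (g0 : forall z, 0 <= g z).

Let G (z : T1 * T2) := (\1_D z.1 * \1_E z.2 * g z)%:E.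

Let mG : measurable_fun [set: T1 * T2] G.
Proof.
apply/measurable_EFinP; apply: measurable_funM => //; apply: measurable_funM.
- by apply: measurableT_comp => //; exact: measurable_indic.
- by apply: measurableT_comp => //; exact: measurable_indic.
Qed.

Let G0 z : (0 <= G z)%E.
Proof. by rewrite lee_fin mulr_ge0// mulr_ge0. Qed.

Let intE x : \1_D x = 1 :> R -> (\int[m2]_(y in E) (g (x, y))%:E = \int[m2]_y G (x, y))%E.
Proof.
move=> Dx; rewrite integral_mkcond; apply: eq_integral => y _.
rewrite patchE /G /= Dx mul1r indicE; case: ifPn => _; first by rewrite mul1r.
by rewrite mul0r.
Qed.

Let intD y : \1_E y = 1 :> R -> (\int[m1]_(x in D) (g (x, y))%:E = \int[m1]_x G (x, y))%E.
Proof.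
move=> Ey; rewrite integral_mkcond; apply: eq_integral => x _.
rewrite patchE /G /= Ey mulr1 indicE; case: ifPn => _; first by rewrite mul1r.
by rewrite mul0r.
Qed.

Lemma measurable_fun_integral_on :
  measurable_fun D (fun x => \int[m2]_(y in E) (g (x, y))%:E)%E.
Proof.
apply: (eq_measurable_fun (fun x => \int[m2]_y G (x, y))%E).
  by move=> x Dx; rewrite intE// indicE Dx.
by apply: measurable_funTS; exact: measurable_fun_fubini_tonelli_F.
Qed.

Lemma fubini_tonelli_on :
  (\int[m1]_(x in D) \int[m2]_(y in E) (g (x, y))%:E =
   \int[m2]_(y in E) \int[m1]_(x in D) (g (x, y))%:E)%E.
Proof.
rewrite integral_mkcond [RHS]integral_mkcond.
transitivity (\int[m1]_x \int[m2]_y G (x, y))%E.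
  apply: eq_integral => x _; rewrite patchE; case: ifPn => Dx.
    by rewrite intE// indicE Dx.
  by apply/esym/integral0_eq => y _; rewrite /G/= indicE (negbTE Dx) !mul0r.
rewrite fubini_tonelli//; apply: eq_integral => y _; rewrite patchE; case: ifPn => Ey.
  by rewrite intD// indicE Ey.
by apply: integral0_eq => x _; rewrite /G/= [\1_E _]indicE (negbTE Ey) mulr0 mul0r.
Qed.

End tonelli_on.

(** ** The growth of the moments *)

Section moment.
Context (R : realType).
Notation mu := (@lebesgue_measure R).
Variables (t0 t1 p q : R).
Hypotheses (t01 : t0 < t1) (p1 : 1 < p) (q1 : 1 < q) (pq : p^-1 + q^-1 = 1).
Notation D := (`[t0, t1]%classic).
(** Dominates every power of [t1 - t0] with exponent in [[0, 1]], so that the kernel integrals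
    depend on the exponent only through [1 / (1 - b)]. *)
Let S := 1 + (t1 - t0).
Variables (h : R -> R) (m : R).
Hypotheses (mh : measurable_fun [set: R] h) (h0 : forall x, 0 <= h x).
Hypotheses (m0 : 0 < m) (hm : (\int[mu]_(x in D) (h x `^ p)%:E <= (m `^ p)%:E)%E).

Let S1 : 1 <= S. Proof. by rewrite /S lerDl subr_ge0 ltW. Qed.
Let p0 : 0 < p. Proof. exact: lt_trans p1. Qed.
Let q0 : 0 < q. Proof. exact: lt_trans q1. Qed.

Let mkt b (t : R) : measurable_fun [set: R] (fun s => kern b (t - s)).
Proof. apply: (measurableT_comp (measurable_kern b)); exact: measurable_funB. Qed.

Let mks b (s : R) : measurable_fun [set: R] (fun t => kern b (t - s)).
Proof. apply: (measurableT_comp (measurable_kern b)); exact: measurable_funB. Qed.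

Let mhr c : measurable_fun [set: R] (fun s => h s `^ c).
Proof. by apply: (measurableT_comp (measurable_powR c)). Qed.

Lemma kernM b c u : kern b u * kern c u = kern (b + c) u :> R.
Proof.
rewrite /kern; case: ifPn => [u0|_]; last by rewrite mul0r.
by rewrite -powRD ?opprD// (gt_eqF u0) implybT.
Qed.

Lemma integral_kernl_le b (t : R) : D t -> 0 <= b -> b < 1 ->
  (\int[mu]_(s in D) (kern b (t - s))%:E <= (S / (1 - b))%:E)%E.
Proof.
rewrite /= in_itv/= => /andP[t0t tt1] b0 b1.
have b10 : 0 < 1 - b by rewrite subr_gt0.
move: t0t; rewrite le_eqVlt => /predU1P[<-|t0t].
  rewrite integral0_eq ?lee_fin ?divr_ge0 ?(le_trans _ S1) ?ltW//.
  by move=> s; rewrite /= in_itv/= => /andP[t0s _]; rewrite kern_le0// subr_le0.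
apply: le_trans (integral_kernl t1 t0t b0 b1) _.
rewrite lee_fin ler_pM2r ?invr_gt0//; by apply: powR_le_add1; lra.
Qed.

Lemma integral_kernr_le b (s : R) : D s -> 0 <= b -> b < 1 ->
  (\int[mu]_(t in D) (kern b (t - s))%:E <= (S / (1 - b))%:E)%E.
Proof.
rewrite /= in_itv/= => /andP[t0s st1] b0 b1.
have b10 : 0 < 1 - b by rewrite subr_gt0.
move: st1; rewrite le_eqVlt => /predU1P[->|st1].
  rewrite integral0_eq ?lee_fin ?divr_ge0 ?(le_trans _ S1) ?ltW//.
  by move=> t; rewrite /= in_itv/= => /andP[_ tt1]; rewrite kern_le0// subr_le0.
apply: le_trans (integral_kernr t0 st1 b0 b1) _.
rewrite lee_fin ler_pM2r ?invr_gt0//; by apply: powR_le_add1; lra.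
Qed.

Let A (t : R) := (\int[mu]_(s in D) (kern q^-1 (t - s) * h s)%:E)%E.
(** The exponent [1/2] stays below 1 independently of [r], so integrating [G] in [t] costs a
    constant free of [r]. *)
Let G (t : R) := (\int[mu]_(s in D) (kern 2^-1 (t - s) * h s `^ p)%:E)%E.

Lemma RL_pointwise_le r t : p + q <= r -> D t ->
  (A t `^ r <= ((2 * S * r `^ q^-1) `^ r * m `^ (r - p))%:E * G t)%E.
Proof.
move=> pqr Dt.
have r0 : 0 < r by apply: lt_le_trans pqr; rewrite addr_gt0.
have pr : p < r by apply: lt_le_trans pqr; rewrite ltrDl.
have qr : q < r by apply: lt_le_trans pqr; rewrite ltrDr.
set a := 2 * S * r `^ q^-1.
have S0 : 0 < S by apply: lt_le_trans S1.
have a0 : 0 < a by rewrite !mulr_gt0// powR_gt0.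
have G0 : (0 <= G t)%E.
  by apply: integral_ge0 => s _; rewrite lee_fin mulr_ge0 ?powR_ge0 ?kern_ge0.
(* If [G t] is infinite, so is the right side, its coefficient being positive because [m] is. *)
have [Gfin|] := boolP (G t < +oo)%E; last first.
  rewrite -leNgt leye_eq => /eqP ->; rewrite gt0_muley ?leey//.
  by rewrite lte_fin mulr_gt0 ?powR_gt0.
have Gfn : G t \is a fin_num by rewrite ge0_fin_numE.
have [g GE g0] : exists2 g, G t = g%:E & 0 <= g.
  by exists (fine (G t)); [rewrite fineK|rewrite fine_ge0].
(* Bound for the [L^p] norm of [kern e * h]; [a] bounds the [L^q] norm of the remaining kernel. *)
pose b := g `^ r^-1 * m `^ (1 - p / r).
have b0 : 0 <= b by rewrite mulr_ge0 ?powR_ge0.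
pose e := (2 * r)^-1.
have e0 : 0 < e by rewrite invr_gt0 mulr_gt0.
have er : e * r = 2^-1 by rewrite /e invfM -mulrA mulVf ?mulr1 ?gt_eqF.
have eq_ : e * q <= 2^-1 by rewrite -er ler_pM2l// ltW.
have rp0 : 0 < r - p by rewrite subr_gt0.
(* The kernel is [kern e * kern (1/q - e)] with [e r = 1/2]: Hoelder once for this
   product, then once more for the factor [kern e * h]. *)
have Aab : (A t <= (b * a)%:E)%E.
  rewrite /A; under eq_integral => s _.
    rewrite (_ : q^-1 = e + (q^-1 - e)); last by rewrite addrC subrK.
    rewrite -kernM mulrAC. over.
  apply: (@hoelder_le _ _ R mu D (fun s => kern e (t - s) * h s)
    (fun s => kern (q^-1 - e) (t - s)) p q) => //.
  - by apply: measurable_funM => //; exact: mkt.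
  - exact: mkt.
  - by move=> s; rewrite mulr_ge0// kern_ge0.
  - by move=> s; exact: kern_ge0.
  - exact: ltW.
  - under eq_integral => s _.
      rewrite powRM ?kern_ge0// kern_powR ?gt_eqF//.
      rewrite (_ : h s `^ p = h s `^ (p * (p / r)) * h s `^ (p * (1 - p / r))); last first.
        by rewrite -powRD -mulrDr addrC subrK mulr1// (gt_eqF p0).
      rewrite mulrA. over.
    rewrite (_ : b `^ p = (g `^ (p / r)) * (m `^ (p * (1 - p / r)))); last first.
      rewrite /b powRM ?powR_ge0// -!powRrM; congr (_ `^ _ * _ `^ _); first exact: mulrC.
      exact: mulrC.
    (* The split of [h ^ p] is tuned to the exponents [r / p] and [r / (r - p)]: the first factor
       becomes the integrand of [G], the second becomes [h ^ p]. *)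
    apply: (@hoelder_le _ _ R mu D (fun s => kern (e * p) (t - s) * h s `^ (p * (p / r)))
      (fun s => h s `^ (p * (1 - p / r))) (r / p) (r / (r - p))) => //.
    + by apply: measurable_funM; [exact: mkt|exact: mhr].
    + exact: mhr.
    + by move=> s; rewrite mulr_ge0 ?powR_ge0// kern_ge0.
    + by move=> s; rewrite powR_ge0.
    + by rewrite divr_gt0.
    + by rewrite divr_gt0.
    + by rewrite !invf_div -mulrDl addrC subrK mulfV// gt_eqF.
    + exact: powR_ge0.
    + exact: powR_ge0.
    + under eq_integral => s _.
        rewrite powRM ?kern_ge0 ?powR_ge0// kern_powR ?gt_eqF ?divr_gt0//.
        rewrite -powRrM (_ : e * p * (r / p) = 2^-1); last first.
          by rewrite -er; field; rewrite gt_eqF.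
        rewrite (_ : p * (p / r) * (r / p) = p); last by field; rewrite !gt_eqF.
        over.
      rewrite -/(G t) GE -powRrM (_ : p / r * (r / p) = 1) ?powRr1//.
      by field; rewrite !gt_eqF.
    + under eq_integral => s _.
        rewrite -powRrM (_ : p * (1 - p / r) * (r / (r - p)) = p); last first.
          by field; rewrite !gt_eqF.
        over.
      rewrite -powRrM (_ : p * (1 - p / r) * (r / (r - p)) = p)//.
      by field; rewrite !gt_eqF.
  (* Here [(1/q - e) q = 1 - e q], so the integral is at most [S / (e q) = 2 S r / q]; this is the
     only source of growth in [r]. The bound [e q <= 1/2] keeps the exponent nonnegative. *)
  - under eq_integral do rewrite kern_powR ?gt_eqF//.
    rewrite mulrBl mulVf ?gt_eqF//.
    apply: le_trans (integral_kernl_le Dt _ _) _.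
    + by lra.
    + by rewrite ltrBlDr ltrDl mulr_gt0.
    rewrite lee_fin opprB addrC subrK.
    rewrite /a powRM ?mulr_ge0 ?powR_ge0 ?(ltW S0)// -powRrM mulVf ?gt_eqF// powRr1 ?(ltW r0)//.
    apply: (@le_trans _ _ (2 * S * r)); last first.
      rewrite ler_pM2r//; apply: le1r_powR; last exact: ltW.
      by have := S1; lra.
    rewrite ler_pdivrMr ?mulr_gt0// (_ : 2 * S * r * (e * q) = 2 * (e * r) * (S * q)).
      by rewrite er mulfV// mul1r ler_peMr ?(ltW S0)// ltW.
    by ring.
rewrite GE -EFinM.
apply: (@le_trans _ _ ((b * a)%:E `^ r)%E).
  apply: gt0_ler_poweR => //.
  - exact: ltW.
  - by rewrite in_itv/= leey andbT; apply: integral_ge0 => s _; rewrite lee_fin mulr_ge0// kern_ge0.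
  - by rewrite in_itv/= leey andbT lee_fin mulr_ge0// ltW.
have br : b `^ r = g * m `^ (r - p).
  rewrite /b powRM ?powR_ge0// -!powRrM mulVf ?gt_eqF// powRr1//.
  by congr (_ * _ `^ _); field; rewrite gt_eqF.
rewrite poweR_EFin lee_fin powRM ?(ltW a0)// br.
by rewrite mulrC mulrA mulrAC.
Qed.

Let mA : measurable_fun D A.
Proof.
apply: (@measurable_fun_integral_on _ _ _ _ R mu D D
  (fun z : R * R => kern q^-1 (z.1 - z.2) * h z.2)) => //.
- apply: measurable_funM; last exact: measurableT_comp.
  by apply: (measurableT_comp (measurable_kern _)); exact: measurable_funB.
- by move=> z; rewrite mulr_ge0// kern_ge0.
Qed.

(** Integrating [G] in [t] adds a factor [2 S m ^ p]. As [2 S >= 1], it is at most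
    [(2 S) ^ r m ^ p], which gives the second [2 S] in the constant [4 S ^ 2]. *)
Lemma RL_moment_large r : p + q <= r ->
  (\int[mu]_(t in D) (A t `^ r) <= ((4 * S ^+ 2 * r `^ q^-1 * m) `^ r)%:E)%E.
Proof.
move=> pqr.
have r0 : 0 < r by apply: lt_le_trans pqr; rewrite addr_gt0.
have r1 : 1 <= r by have := lt_trans p1 (_ : p < p + q); rewrite ltrDl q0 => /(_ isT); lra.
have S0 : 0 < S by apply: lt_le_trans S1.
pose g z := kern 2^-1 (z.1 - z.2) * h z.2 `^ p.
have mg : measurable_fun [set: R * R] g.
  apply: measurable_funM; last by apply: (measurableT_comp (mhr p)).
  by apply: (measurableT_comp (measurable_kern _)); exact: measurable_funB.
have g0 z : 0 <= g z by rewrite mulr_ge0 ?kern_ge0 ?powR_ge0.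
set c := (2 * S * r `^ q^-1) `^ r * m `^ (r - p).
have c0 : 0 <= c by rewrite mulr_ge0 ?powR_ge0.
have G0 t : (0 <= G t)%E.
  by apply: integral_ge0 => s _; rewrite lee_fin mulr_ge0 ?powR_ge0 ?kern_ge0.
have mG : measurable_fun D G by exact: (@measurable_fun_integral_on _ _ _ _ R mu D D g).
apply: (@le_trans _ _ (\int[mu]_(t in D) (c%:E * G t))%E).
  apply: le_lower_integral => t Dt; first exact: poweR_ge0.
  exact: RL_pointwise_le.
rewrite ge0_integralZl_EFin//.
have : (\int[mu]_(t in D) G t <= (2 * S * m `^ p)%:E)%E.
  rewrite (@fubini_tonelli_on _ _ _ _ R mu mu D D g)//.
  apply: (@le_trans _ _ (\int[mu]_(s in D) ((2 * S)%:E * (h s `^ p)%:E))%E).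
    apply: le_lower_integral => s Ds.
      by apply: integral_ge0 => t _; rewrite lee_fin.
    under eq_integral do rewrite /g/= EFinM muleC.
    rewrite ge0_integralZl_EFin ?powR_ge0//; last 2 first.
    - by move=> t _; rewrite lee_fin kern_ge0.
    - by apply/measurable_EFinP/measurable_funTS; exact: mks.
    rewrite muleC lee_wpmul2r ?lee_fin ?powR_ge0//.
    apply: le_trans (integral_kernr_le Ds _ _) _; [lra|lra|].
    by rewrite lee_fin (_ : 1 - 2^-1 = 2^-1 :> R) ?invrK 1?mulrC//; lra.
  rewrite ge0_integralZl_EFin//; last 3 first.
  - by move=> s _; rewrite lee_fin powR_ge0.
  - by apply/measurable_EFinP/measurable_funTS; exact: mhr.
  - by rewrite mulr_ge0// ltW.
  by rewrite (EFinM (2 * S)) lee_wpmul2l// lee_fin mulr_ge0// ltW.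
move=> hG; apply: (@le_trans _ _ (c%:E * (2 * S * m `^ p)%:E)%E).
  by rewrite lee_wpmul2l// lee_fin.
rewrite -EFinM lee_fin /c.
have -> : (2 * S * r `^ q^-1) `^ r * m `^ (r - p) * (2 * S * m `^ p) =
    (2 * S * r `^ q^-1) `^ r * m `^ r * (2 * S).
  have -> : m `^ r = m `^ (r - p) * m `^ p.
    by rewrite -powRD ?subrK// (gt_eqF m0) implybT.
  by ring.
have -> : 4 * S ^+ 2 * r `^ q^-1 * m = (2 * S * r `^ q^-1) * m * (2 * S) by ring.
rewrite [in leRHS]powRM ?mulr_ge0 ?powR_ge0 ?(ltW S0) ?(ltW m0)//.
rewrite [((_ * m) `^ r)]powRM ?mulr_ge0 ?powR_ge0 ?(ltW S0) ?(ltW m0)//.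
apply: ler_wpM2l; first by rewrite mulr_ge0 ?powR_ge0.
by apply: le1r_powR => //; have := S1; lra.
Qed.

Lemma RL_moment r : 1 <= r ->
  (\int[mu]_(t in D) (A t `^ r) <=
    ((4 * S ^+ 3 * (p + q) `^ q^-1 * r `^ q^-1 * m) `^ r)%:E)%E.
Proof.
move=> r1; have r0 : 0 < r by apply: lt_le_trans r1.
have S0 : 0 < S by apply: lt_le_trans S1.
have pq0 : 0 < p + q by rewrite addr_gt0.
have rq1 : 1 <= r `^ q^-1.
  by rewrite -(powRr0 r); apply: ler_powR => //; rewrite invr_ge0 ltW.
have pqq1 : 1 <= (p + q) `^ q^-1.
  by rewrite -(powRr0 (p + q)); apply: ler_powR; rewrite ?invr_ge0 ?(ltW q0)//; have := q0; have := p1; lra.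
have [pqr|rpq] := leP (p + q) r.
  apply: le_trans (RL_moment_large pqr) _.
  rewrite lee_fin; apply: ge0_ler_powR; rewrite ?nnegrE ?(ltW r0)//.
  - by rewrite !mulr_ge0 ?powR_ge0 ?exprn_ge0 ?ltW.
  - by rewrite !mulr_ge0 ?powR_ge0 ?exprn_ge0 ?ltW.
  rewrite ler_pM2r// ler_pM2r ?powR_gt0// -mulrA ler_pM2l// [S ^+ 3]exprSr -mulrA.
  rewrite ler_peMr ?exprn_ge0 ?(ltW S0)//.
  by rewrite -[leLHS]mulr1 ler_pM.
set r0' := p + q in rpq *.
(* The bound already known at the exponent [p + q]. Splitting at level [l] gives
   [l ^ r (t1 - t0) + l ^ r = l ^ r S], hence the third factor [S] in the constant. *)
pose l := 4 * S ^+ 2 * r0' `^ q^-1 * m.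
have l0 : 0 < l by rewrite !mulr_gt0 ?powR_gt0 ?exprn_gt0.
have A0 t : (0 <= A t)%E by apply: integral_ge0 => s _; rewrite lee_fin mulr_ge0// kern_ge0.
have mAr c : measurable_fun D (fun t => A t `^ c)%E.
  exact: (measurableT_comp (measurable_poweR c) mA).
(* [x `^ r <= l `^ r + l `^ (r - r0') * x `^ r0'] reduces small exponents to [r0']. *)
apply: (@le_trans _ _ (\int[mu]_(t in D) ((l `^ r)%:E + (l `^ (r - r0'))%:E * (A t `^ r0')))%E).
  apply: le_lower_integral => t Dt; first exact: poweR_ge0.
  have := A0 t; case: (A t) => [x| |//].
    rewrite lee_fin => x0; rewrite !poweR_EFin -EFinM -EFinD lee_fin.
    have [xl|lx] := leP x l.
      apply: ler_wpDr; first by rewrite mulr_ge0 ?powR_ge0.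
      by apply: ge0_ler_powR; rewrite ?nnegrE ?(ltW r0) ?(ltW l0).
    apply: ler_wpDl; first exact: powR_ge0.
    have x0' : 0 < x by apply: lt_trans lx.
    rewrite -{1}(subrK r0' r) powRD ?(gt_eqF x0') ?implybT//.
    rewrite ler_wpM2r ?powR_ge0// -opprB !powRN.
    rewrite lef_pV2 ?posrE ?powR_gt0//.
    by apply: ge0_ler_powR; rewrite ?nnegrE ?subr_ge0 ?ltW.
  by rewrite !poweRyr ?gt_eqF// gt0_muley ?lte_fin ?powR_gt0// addey// leey.
rewrite ge0_integralD//; last 3 first.
- by move=> t _; rewrite lee_fin powR_ge0.
- by move=> t _; rewrite mule_ge0 ?lee_fin ?powR_ge0 ?poweR_ge0.
- by apply: measurable_funeM; exact: mAr.
rewrite ge0_integralZl_EFin ?powR_ge0//; last 2 first.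
- by move=> t _; exact: poweR_ge0.
- exact: mAr.
rewrite integral_cst//= lebesgue_measure_itv/= lte_fin t01.
apply: (@le_trans _ _ ((l `^ r)%:E * (t1 - t0)%:E + (l `^ (r - r0'))%:E * (l `^ r0')%:E)%E).
  rewrite leeD2l// lee_wpmul2l ?lee_fin ?powR_ge0//.
  exact: RL_moment_large.
rewrite -!EFinM -EFinD lee_fin -powRD ?(gt_eqF l0) ?implybT// subrK.
rewrite -{2}[l `^ r]mulr1 -mulrDr [t1 - t0 + 1]addrC -/S.
have -> : 4 * S ^+ 3 * r0' `^ q^-1 * r `^ q^-1 * m = l * (S * r `^ q^-1) by rewrite /l; ring.
have rS : 0 <= S * r `^ q^-1 by rewrite mulr_ge0 ?powR_ge0 ?ltW.
rewrite powRM ?(ltW l0)// ler_wpM2l ?powR_ge0//.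
apply: (@le_trans _ _ (S * r `^ q^-1)).
  by rewrite ler_peMr// ltW.
apply: le1r_powR => //; rewrite -[leLHS]mulr1; exact: ler_pM.
Qed.

End moment.

(** ** The mean oscillation *)

(** Independent of [t], so its integral against [f] is a constant. The gap [w] keeps [a - s] above
    [w], away from the singularity: for [b >= 0] the cut kernel is at most [w ^ (- b)]. *)
Definition kcut (R : realType) (b a w s : R) : R :=
  if s < a - w then kern b (a - s) else 0.

Section oscillation.
Context (R : realType).
Notation mu := (@lebesgue_measure R).

Lemma kcut_ge0 (b a w s : R) : 0 <= kcut b a w s.
Proof. by rewrite /kcut; case: ifP => // _; exact: kern_ge0. Qed.

Lemma measurable_kcut (b a w : R) : measurable_fun [set: R] (kcut b a w).
Proof.
apply: measurable_fun_ifT; [exact: measurable_fun_ltr| |exact: measurable_cst].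
by apply: (measurableT_comp (measurable_kern b)); exact: measurable_funB.
Qed.

(** Write [y ^ (- b) = x ^ (- b) (x/y) ^ b]. For [b] in [[0, 1]], [(x/y) ^ b] lies between [x/y] and
    1, and [1 - x/y = (y - x) / y <= (y - x) / x]. *)
Lemma powRN_diff_le (b x y : R) : 0 < x -> x <= y -> 0 <= b -> b <= 1 ->
  `|y `^ (- b) - x `^ (- b)| <= (y - x) * x `^ (- (b + 1)).
Proof.
move=> x0 xy b0 b1; have y0 : 0 < y by exact: lt_le_trans xy.
have yx : y `^ (- b) = x `^ (- b) * (x / y) `^ b.
  rewrite powRM ?invr_ge0 ?ltW// mulrA -powRD ?(gt_eqF x0) ?implybT// addNr powRr0 mul1r.
  by rewrite -powR_inv1 ?ltW// -powRrM mulN1r.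
have h1 : x / y <= (x / y) `^ b.
  by apply: ger1_powR => //; rewrite divr_gt0//= ler_pdivrMr// mul1r.
have h2 : (x / y) `^ b <= 1.
  rewrite -(powRr0 (x / y)); apply: ger_powR => //.
  by rewrite divr_gt0//= ler_pdivrMr// mul1r.
rewrite yx -{2}[x `^ (- b)]mulr1 -mulrBr normrM ger0_norm ?powR_ge0//.
rewrite ler0_norm ?subr_le0// opprB.
rewrite opprD powRD ?(gt_eqF x0) ?implybT// powR_inv1 ?(ltW x0)// mulrCA.
rewrite ler_wpM2l ?powR_ge0//.
apply: (@le_trans _ _ (1 - x / y)); first by rewrite lerD2l lerN2.
rewrite -(mulfV (lt0r_neq0 y0)) -mulrBl ler_wpM2l ?subr_ge0//.
by rewrite lef_pV2.
Qed.

Variables (t0 t1 p q : R).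
Hypotheses (p1 : 1 < p) (q1 : 1 < q) (pq : p^-1 + q^-1 = 1).
Notation D := (`[t0, t1]%classic).
Variables (h : R -> R) (m : R).
Hypotheses (mh : measurable_fun [set: R] h) (h0 : forall x, 0 <= h x).
Hypotheses (m0 : 0 < m) (hm : (\int[mu]_(x in D) (h x `^ p)%:E <= (m `^ p)%:E)%E).
Variables (a b : R).
Hypothesis ab : a < b.
Let w := b - a.

Let p0 : 0 < p. Proof. exact: lt_trans p1. Qed.
Let q0 : 0 < q. Proof. exact: lt_trans q1. Qed.
Let w0 : 0 < w. Proof. by rewrite subr_gt0. Qed.

(** Far from [[a, b]], one [w] comes from the increment [t - a] and one from the length of the
    interval. Near it, [p = 1 / (1 - 1/q)] comes from integrating the kernel in [t], and
    [b - s <= 2 w]. *)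
Definition RL_osc_majorant (s : R) : R :=
  if s < a - w then w ^+ 2 * (a - s) `^ (- (q^-1 + 1))
  else if s <= b then (2 * w) `^ p^-1 * p else 0.
Let V := RL_osc_majorant.

Let V0 s : 0 <= V s.
Proof.
rewrite /V /RL_osc_majorant; case: ifP => _.
  by rewrite mulr_ge0 ?powR_ge0 ?exprn_ge0 ?ltW.
by case: ifP => // _; rewrite mulr_ge0 ?powR_ge0 ?ltW.
Qed.

Let mV : measurable_fun [set: R] V.
Proof.
apply: measurable_fun_ifT; first exact: measurable_fun_ltr.
- apply: measurable_funM => //.
  by apply: (measurableT_comp (measurable_powR _)); exact: measurable_funB.
- apply: measurable_fun_ifT; [exact: measurable_fun_ler|exact: measurable_cst..].
Qed.

Lemma integral_kern_kcut_le s :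
  (\int[mu]_(t in `[a, b]) (`|kern q^-1 (t - s) - kcut q^-1 a w s|)%:E <= (V s)%:E)%E.
Proof.
have q_0 : 0 <= q^-1 by rewrite invr_ge0 ltW.
have q_1 : q^-1 < 1 by rewrite invf_lt1.
rewrite /V /RL_osc_majorant /kcut; case: ifPn => [saw|].
  have as0 : 0 < a - s by have := w0; lra.
  apply: (@le_trans _ _ (\int[mu]_(t in `[a, b]) (w * (a - s) `^ (- (q^-1 + 1)))%:E)%E).
    apply: le_lower_integral => t; rewrite /= in_itv/= => /andP[at_ tb].
      by rewrite lee_fin.
    rewrite lee_fin !kern_gt0//; last by lra.
    apply: le_trans (powRN_diff_le _ _ _ _) _ => //; [lra|exact: ltW|].
    by apply: ler_wpM2r; [exact: powR_ge0|rewrite /w; lra].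
  rewrite integral_cst//= lebesgue_measure_itv/= lte_fin ab -EFinM lee_fin.
  by rewrite -/w mulrAC expr2.
rewrite -leNgt => aws; under eq_integral do rewrite subr0 ger0_norm ?kern_ge0//.
case: ifPn => [|]; last first.
  rewrite -ltNge => bs; rewrite integral0_eq// => t; rewrite /= in_itv/= => /andP[_ tb].
  by rewrite kern_le0// subr_le0 (le_trans tb)// ltW.
rewrite le_eqVlt => /predU1P[sb|sb].
  rewrite integral0_eq ?lee_fin ?mulr_ge0 ?powR_ge0 ?(ltW p0)// => t.
  by rewrite /= in_itv/= => /andP[_ tb]; rewrite kern_le0// subr_le0 sb.
apply: le_trans (integral_kernr a sb q_0 q_1) _.
rewrite (_ : 1 - q^-1 = p^-1); last by rewrite -pq addrK.
rewrite invrK lee_fin ler_pM2r//; apply: ge0_ler_powR.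
- by rewrite invr_ge0 ltW.
- by rewrite nnegrE; lra.
- by rewrite nnegrE mulr_ge0// ltW.
- by rewrite /w; move: aws; rewrite /w; lra.
Qed.

(** Far part: [w ^ (2 q)] times the integral of [u ^ (- q - 1)] over [u > w] is [w ^ q / q]. Near
    part: an interval of length [2 w] times [((2 w) ^ (1/p) p) ^ q] is [(2 w p) ^ q], because
    [q/p + 1 = q]. *)
Lemma integral_majorant_le :
  (\int[mu]_(s in D) (V s `^ q)%:E <= ((w * (1 + (2 * p) `^ q)) `^ q)%:E)%E.
Proof.
pose f1 s := if s < a - w then V s `^ q else 0.
pose f2 s := if s < a - w then 0 else V s `^ q.
have mVq : measurable_fun [set: R] (fun s => V s `^ q).
  exact: (measurableT_comp (measurable_powR q)).
have mf1 : measurable_fun [set: R] f1.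
  by apply: measurable_fun_ifT => //; exact: measurable_fun_ltr.
have mf2 : measurable_fun [set: R] f2.
  by apply: measurable_fun_ifT => //; exact: measurable_fun_ltr.
have f10 s : 0 <= f1 s by rewrite /f1; case: ifP => // _; exact: powR_ge0.
have f20 s : 0 <= f2 s by rewrite /f2; case: ifP => // _; exact: powR_ge0.
have -> : (\int[mu]_(s in D) (V s `^ q)%:E =
    \int[mu]_(s in D) (f1 s)%:E + \int[mu]_(s in D) (f2 s)%:E)%E.
  rewrite -ge0_integralD//; last 4 first.
  - by move=> s _; rewrite lee_fin.
  - by apply/measurable_EFinP/measurable_funTS.
  - by move=> s _; rewrite lee_fin.
  - by apply/measurable_EFinP/measurable_funTS.
  apply: eq_integral => s _; rewrite /f1 /f2 -EFinD.
  by case: ifP => _; rewrite ?addr0 ?add0r.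
have far : (\int[mu]_(s in D) (f1 s)%:E <= (w `^ q)%:E)%E.
  have [ta|at_] := ltP t0 (a - w); last first.
    rewrite integral0_eq ?lee_fin ?powR_ge0// => s; rewrite /= in_itv/= => /andP[t0s _].
    by rewrite /f1 ltNge (le_trans at_).
  apply: le_trans.
    apply: (@le_integral_oo _ _ f1 (fun s => w `^ (q + q) * (a - s) `^ (- q - 1)) t0 (a - w)) => //.
    - by move=> x _; rewrite mulr_ge0 ?powR_ge0.
    - move=> x _ /andP[t0x xaw]; rewrite /f1 xaw /V /RL_osc_majorant xaw.
      rewrite powRM ?powR_ge0 ?exprn_ge0 ?(ltW w0)// -powRrM.
      rewrite expr2 powRM ?(ltW w0)// -powRD ?(gt_eqF w0) ?implybT//.
      by rewrite (_ : - (q^-1 + 1) * q = - q - 1)//; field; rewrite gt_eqF.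
    - move=> x; rewrite /= in_itv/= => /andP[t0x _] xt0 _.
      rewrite lt_neqAle eq_sym xt0 t0x/= => /negbTE xaw.
      by rewrite /f1 xaw.
  apply: (@FTC_le R _ (fun s => w `^ (q + q) / q * (a - s) `^ (- q))) => //.
  - by move=> x _; rewrite mulr_ge0 ?powR_ge0.
  - move=> x /andP[_ xaw].
    have xa : x < a by have := w0; lra.
    have h1 := is_derive_powRl (- q - 1) xa.
    by have [] := is_deriveZ (w `^ (q + q)) h1.
  - move=> x /andP[_ xaw].
    have xa : x < a by have := w0; lra.
    have h1 := is_derive_powRl (- q) xa.
    have h2 := is_deriveZ (w `^ (q + q) / q) h1.
    apply: (is_derive_eq h2); rewrite /= /GRing.scale/= mulNr opprK mulrA.
    by rewrite mulfVK// gt_eqF.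
  - move=> x y t0x xy yaw; rewrite -mulrBr.
    have : (a - y) `^ (- q) <= w `^ (- q).
      rewrite !powRN lef_pV2 ?posrE ?powR_gt0//; last by have := w0; lra.
      by apply: ge0_ler_powR; rewrite ?nnegrE ?(ltW q0) ?(ltW w0)//; have := w0; lra.
    move=> ayw; apply: (@le_trans _ _ (w `^ (q + q) / q * w `^ (- q))).
      apply: ler_wpM2l; first by rewrite divr_ge0 ?powR_ge0 ?ltW.
      by rewrite lerBlDr (le_trans ayw)// lerDl powR_ge0.
    rewrite mulrAC -powRD ?(gt_eqF w0) ?implybT// addrK.
    by rewrite ler_pdivrMr// ler_peMr ?powR_ge0// ltW.
have near : (\int[mu]_(s in D) (f2 s)%:E <= ((w * (2 * p)) `^ q)%:E)%E.
  apply: (@le_trans _ _ (\int[mu]_(s in `[(a - w)%R, b]) (((2 * w) `^ p^-1 * p) `^ q)%:E)%E).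
    rewrite integral_mkcond [leRHS]integral_mkcond.
    apply: le_lower_integral => s _.
      by apply: erestrict_ge0 => x _; rewrite lee_fin.
    rewrite !patchE; case: ifPn => [sD|_]; last first.
      by case: ifPn => // _; rewrite lee_fin powR_ge0.
    case: ifPn => [_|].
      rewrite /f2 /V /RL_osc_majorant lee_fin; case: ltP => _; first exact: powR_ge0.
      by case: ifPn => // _; rewrite powR0 ?gt_eqF// powR_ge0.
    rewrite notin_setE/= in_itv/= => /negP; rewrite negb_and -!ltNge.
    rewrite /f2 /V /RL_osc_majorant; case: ltP => //= saw bs.
    by rewrite [s <= b]leNgt bs/= powR0 ?gt_eqF.
  rewrite integral_cst//= lebesgue_measure_itv/= lte_fin.
  have awb : a - w < b by have := w0; have := ab; lra.
  rewrite awb -EFinB (_ : b - (a - w) = 2 * w); last by rewrite /w; ring.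
  rewrite -EFinM lee_fin powRM ?powR_ge0 ?(ltW p0)// -powRrM mulrAC.
  have w20 : 0 < 2 * w by rewrite mulr_gt0.
  rewrite -{2}[2 * w]powRr1 ?(ltW w20)// -powRD ?(gt_eqF w20) ?implybT//.
  have -> : p^-1 * q + 1 = q.
    by rewrite -[X in _ + X](mulVf (lt0r_neq0 q0)) -mulrDl pq mul1r.
  by rewrite -powRM ?(ltW p0) ?(ltW w20)// mulrA [w * 2]mulrC.
apply: le_trans (leeD far near) _.
rewrite -EFinD lee_fin powRM ?mulr_ge0 ?(ltW w0) ?(ltW p0)//.
rewrite -{1}[w `^ q]mulr1 -mulrDr [leRHS]powRM ?(ltW w0) ?addr_ge0 ?powR_ge0//.
apply: ler_wpM2l; first exact: powR_ge0.
by apply: le1r_powR; [rewrite lerDl powR_ge0|exact: ltW].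
Qed.

Lemma RL_oscillation :
  (\int[mu]_(t in `[a, b]) \int[mu]_(s in D)
     (`|kern q^-1 (t - s) - kcut q^-1 a w s| * h s)%:E
   <= (m * (w * (1 + (2 * p) `^ q)))%:E)%E.
Proof.
pose g (z : R * R) := `|kern q^-1 (z.1 - z.2) - kcut q^-1 a w z.2| * h z.2.
have mk s : measurable_fun [set: R] (fun t => `|kern q^-1 (t - s) - kcut q^-1 a w s|).
  apply: measurableT_comp => //; apply: measurable_funB => //.
  by apply: (measurableT_comp (measurable_kern _)); exact: measurable_funB.
have mg : measurable_fun [set: R * R] g.
  apply: measurable_funM; last exact: measurableT_comp.
  apply: measurableT_comp => //; apply: measurable_funB.
    by apply: (measurableT_comp (measurable_kern _)); exact: measurable_funB.
  exact: (measurableT_comp (measurable_kcut _ _ _)).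
have g0 z : 0 <= g z by rewrite mulr_ge0.
rewrite (@fubini_tonelli_on _ _ _ _ R mu mu _ D g)//.
apply: (@le_trans _ _ (\int[mu]_(s in D) (h s * V s)%:E)%E); last first.
  apply: (@hoelder_le _ _ R mu D h V p q) => //.
  - exact: ltW.
  - by rewrite mulr_ge0 ?(ltW w0)// addr_ge0 ?powR_ge0.
  - exact: integral_majorant_le.
apply: le_lower_integral => s _.
  by apply: integral_ge0 => t _; rewrite lee_fin.
under eq_integral do rewrite /g/= mulrC EFinM.
rewrite ge0_integralZl_EFin ?h0//; last by apply/measurable_EFinP/measurable_funTS; exact: mk.
by rewrite EFinM lee_wpmul2l ?lee_fin//; exact: integral_kern_kcut_le.
Qed.

End oscillation.

(** ** The fractional integral of a vector-valued function *)

(* The shift by [1 / (n + 1)] puts the argument of [kern] above [t - s] for all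
   [t] in the [k]-th step, so that [kern b (t - s)] dominates. *)
Definition RL_step_kernel (R : realType) (t0 b : R) (n k : nat) (s : R) : R :=
  let tau := t0 + k%:R / n.+1%:R in
  if s < tau then kern b (tau + n.+1%:R^-1 - s) else 0.

Definition RL_step (R : realType) (t0 : R) (n : nat) (t : R) : nat :=
  Num.truncn ((t - t0) * n.+1%:R).

Section step_kernel.
Context (R : realType).
Variables (t0 t1 b : R).
Hypotheses (b0 : 0 < b).
Notation D := (`[t0, t1]%classic).

Lemma RL_step_itv n t : t0 <= t ->
  t0 + (RL_step t0 n t)%:R / n.+1%:R <= t < t0 + (RL_step t0 n t)%:R / n.+1%:R + n.+1%:R^-1.
Proof.
move=> t0t; have h : 0 <= (t - t0) * n.+1%:R by rewrite mulr_ge0 ?subr_ge0.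
have /andP[h1 h2] := truncn_itv h; apply/andP; split.
  by rewrite -lerBrDl ler_pdivrMr.
rewrite -addrA -{2}[_^-1]mul1r -mulrDl -ltrBlDl ltr_pdivlMr//.
by rewrite natr1.
Qed.

(** Only finitely many steps meet [[t0, t1]]; the single value [None] elsewhere keeps the range
    finite. *)
Lemma simple_fun_RL_step n :
  simple_fun (fun t => if t \in D then Some (RL_step t0 n t) else None).
Proof.
have mD : measurable D by exact: measurable_itv.
split=> [|[k|]].
- apply: (@sub_finite_set _ _ (None |` [set Some k | k in `I_(RL_step t0 n t1).+1])).
    move=> _ [t _ <-]; case: ifPn => [/set_mem|_]; last by left.
    rewrite /= in_itv/= => /andP[t0t tt1]; right; exists (RL_step t0 n t) => //=.
    rewrite ltnS; apply: le_truncn; rewrite ler_wpM2r//.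
    by rewrite lerD2r.
  by rewrite finite_setU; split=> //; exact/finite_image/finite_II.
- rewrite (_ : _ @^-1` _ = D `&` `[t0 + k%:R / n.+1%:R, t0 + k%:R / n.+1%:R + n.+1%:R^-1[%classic).
    by apply: measurableI => //; exact: measurable_itv.
  apply/seteqP; split=> t /=.
    case: ifPn => // /set_mem Dt [<-]; split=> //; rewrite in_itv/=.
    by apply: RL_step_itv; move: Dt; rewrite /= in_itv/= => /andP[].
  move=> [Dt]; rewrite (mem_set (Dt : D t)) in_itv/= => /andP[h1 h2].
  move: Dt; rewrite in_itv/= => /andP[t0t _]; congr Some.
  apply/eqP; rewrite /RL_step truncn_eq ?mulr_ge0 ?subr_ge0//.
  rewrite -ler_pdivrMr// -ltr_pdivlMr// -[k.+1%:R]natr1 mulrDl mul1r.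
  by rewrite lerBrDl h1/= ltrBlDl addrA.
- rewrite (_ : _ @^-1` _ = ~` D); first exact: measurableC.
  apply/seteqP; split=> t /=; first by case: ifPn => // /negP nD _ Dt; exact/nD/mem_set.
  by move=> nD; rewrite memNset.
Qed.

Lemma RL_step_cvg t : t0 <= t ->
  t0 + (RL_step t0 n t)%:R / n.+1%:R @[n --> \oo] --> t.
Proof.
move=> t0t.
have h : t - n.+1%:R^-1 @[n --> \oo] --> t.
  rewrite -[X in _ --> X]subr0; apply: cvgB; first exact: cvg_cst.
  exact: cvg_harmonic.
apply: (squeeze_cvgr _ h (cvg_cst t)).
apply: nearW => n; have /andP[h1 h2] := RL_step_itv n t0t.
by rewrite h1 andbT lerBlDr ltW.
Qed.

Lemma RL_step_kernel_le n t s : t0 <= t ->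
  0 <= RL_step_kernel t0 b n (RL_step t0 n t) s <= kern b (t - s).
Proof.
move=> t0t; rewrite /RL_step_kernel; case: ifPn => [st|_]; last first.
  by rewrite lexx kern_ge0.
rewrite kern_ge0/=; have /andP[h1 h2] := RL_step_itv n t0t.
have ts : 0 < t - s by rewrite subr_gt0 (lt_le_trans st).
have h3 : t - s <= t0 + (RL_step t0 n t)%:R / n.+1%:R + n.+1%:R^-1 - s.
  by rewrite lerD2r ltW.
rewrite !kern_gt0//; last exact: lt_le_trans h3.
rewrite !powRN lef_pV2 ?posrE ?powR_gt0//; last exact: lt_le_trans h3.
apply: ge0_ler_powR; rewrite ?nnegrE ?(ltW b0) ?(ltW ts)//.
exact: le_trans (ltW ts) h3.
Qed.

(** The left end of the step never exceeds [t], so for [s >= t] both sides are 0. For [s < t] it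
    eventually passes [s], and the argument tends to [t - s > 0], where the power is continuous. *)
Lemma RL_step_kernel_cvg t s : t0 <= t ->
  RL_step_kernel t0 b n (RL_step t0 n t) s @[n --> \oo] --> kern b (t - s).
Proof.
move=> t0t; have [ts|st] := leP t s.
  rewrite kern_le0 ?subr_le0// (_ : (fun n => _) = fun=> 0); first exact: cvg_cst.
  apply/funext => n; rewrite /RL_step_kernel ifF//; apply/negbTE; rewrite -leNgt.
  by have /andP[h1 _] := RL_step_itv n t0t; exact: le_trans ts.
have ts0 : 0 < t - s by rewrite subr_gt0.
have lim : t0 + (RL_step t0 n t)%:R / n.+1%:R + n.+1%:R^-1 - s @[n --> \oo] --> t - s.
  apply: cvgB; last exact: cvg_cst.
  rewrite -[t in _ --> t]addr0; apply: cvgD; first exact: RL_step_cvg.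
  exact: cvg_harmonic.
have cont : {for (t - s), continuous (fun u => u `^ (- b))}.
  apply: differentiable_continuous; apply/derivable1_diffP.
  by have [] := is_derive1_powR (- b) ts0.
rewrite kern_gt0//; apply: cvg_trans (continuous_cvg _ cont lim).
apply: near_eq_cvg; near=> n.
rewrite /RL_step_kernel ifT; last first.
  by near: n; apply: (cvgr_gt t) => //; exact: RL_step_cvg.
rewrite kern_gt0//; near: n.
by apply: (cvgr_gt (t - s)) => //; exact: lim.
Unshelve. all: by end_near. Qed.

Lemma measurable_RL_step_kernel n k : measurable_fun [set: R] (RL_step_kernel t0 b n k).
Proof.
apply: measurable_fun_ifT; [exact: measurable_fun_ltr| |exact: measurable_cst].
by apply: (measurableT_comp (measurable_kern b)); exact: measurable_funB.
Qed.

End step_kernel.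

Section RL_bochner.
Context (R : realType) (X : completeNormedModType R).
Notation mu := (@lebesgue_measure R).
Variables (t0 t1 p q : R).
Hypotheses (t01 : t0 < t1) (p1 : 1 < p) (q1 : 1 < q) (pq : p^-1 + q^-1 = 1).
Notation D := (`[t0, t1]%classic).
Variables (f : R -> X).
Hypotheses (mf : strongly_measurable f) (fD : forall x, ~ D x -> f x = 0).

Definition RL_potential (t : R) : \bar R :=
  (\int[mu]_(s in D) (kern q^-1 (t - s) * `|f s|)%:E)%E.
Let A := RL_potential.

(** The fractional integral without its Gamma factor, on a domain independent of [t]: [kern] cuts at
    [s = t], and [f] vanishes below [t0]. *)
Definition RL_full (t : R) : X :=
  bochner_integral mu [set: R] (fun s : R => kern q^-1 (t - s) *: f s).

Let q0 : 0 < q. Proof. exact: lt_trans q1. Qed.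
Let b0 : 0 < q^-1. Proof. by rewrite invr_gt0. Qed.

Lemma integral_norm_kernelE (k : R -> R) : (forall s, 0 <= k s) ->
  (\int[mu]_s (`|k s *: f s|)%:E = \int[mu]_(s in D) (k s * `|f s|)%:E)%E.
Proof.
move=> k0; rewrite [RHS]integral_mkcond; apply: eq_integral => s _.
rewrite patchE; case: ifPn => [_|]; first by rewrite normrZ ger0_norm.
by rewrite notin_setE => /fD ->; rewrite scaler0 normr0.
Qed.

Lemma strongly_measurable_kern (t : R) :
  strongly_measurable (fun s : R => kern q^-1 (t - s) *: f s).
Proof.
apply: strongly_measurableZ => // [|s]; last exact: kern_ge0.
by apply: (measurableT_comp (measurable_kern _)); exact: measurable_funB.
Qed.

Lemma RL_kernelE t s : s <= t -> RL_kernel p^-1 f t s = kern q^-1 (t - s) *: f s.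
Proof.
rewrite /RL_kernel le_eqVlt => /predU1P[->|st].
  (* On the diagonal both sides vanish: 0 to the nonzero power [p^-1 - 1 = - q^-1] is 0. *)
  rewrite subrr kern_le0// powR0//.
  by rewrite -pq opprD addNKr oppr_eq0 invr_eq0 gt_eqF.
by rewrite kern_gt0 ?subr_gt0// -pq opprD addNKr.
Qed.

Lemma integral_kern_lty t : D t -> (A t < +oo)%E ->
  (\int[mu]_(s in `[t0, t]) (`|kern q^-1 (t - s) *: f s|)%:E < +oo)%E.
Proof.
move=> Dt; apply: le_lt_trans.
rewrite /A /RL_potential -integral_norm_kernelE; last by move=> s; exact: kern_ge0.
by rewrite integral_mkcond; apply: le_lower_integral => s _;
  rewrite ?patchE ?erestrict_ge0//; case: ifPn => // _; rewrite lee_fin.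
Qed.

Lemma bochner_integrable_RL t : D t -> (A t < +oo)%E ->
  bochner_integrable mu `[t0, t] (RL_kernel p^-1 f t).
Proof.
move=> Dt At; apply: (@ae_bochner_integrable _ _ _ _ mu _ (fun s : R => kern q^-1 (t - s) *: f s)).
  by apply: aeW => s; rewrite /= in_itv/= => /andP[_ st]; rewrite RL_kernelE.
apply: bochner_approx_exists; [exact: measurable_itv|exact: strongly_measurable_kern|].
exact: integral_kern_lty.
Qed.

Lemma bochner_integral_RL t : D t -> (A t < +oo)%E ->
  bochner_integral mu `[t0, t] (RL_kernel p^-1 f t) = RL_full t.
Proof.
move=> Dt At; rewrite (@ae_eq_bochner_integral _ _ _ _ mu _ _ (fun s : R => kern q^-1 (t - s) *: f s)).
  rewrite bochner_integral_mkcond; last 3 first.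
  - exact: measurable_itv.
  - exact: strongly_measurable_kern.
  - exact: integral_kern_lty.
  congr bochner_integral; apply/funext => s; rewrite indicE.
  case: (boolP (s \in _)) => [_|]; first by rewrite scale1r.
  rewrite notin_setE/= in_itv/= => /negP; rewrite negb_and -!ltNge scale0r => /orP[st0|ts].
    by rewrite fD ?scaler0//= in_itv/= leNgt st0.
  by rewrite kern_le0 ?scale0r// subr_le0 ltW.
by apply: aeW => s; rewrite /= in_itv/= => /andP[_ st]; rewrite RL_kernelE.
Qed.

Lemma bochner_integral_kernel_dist (k k' : R -> R) :
  measurable_fun [set: R] k -> measurable_fun [set: R] k' ->
  (forall s, 0 <= k s) -> (forall s, 0 <= k' s) ->
  (\int[mu]_(s in D) (k s * `|f s|)%:E < +oo)%E ->
  (\int[mu]_(s in D) (k' s * `|f s|)%:E < +oo)%E ->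
  ((`|bochner_integral mu [set: R] (fun s : R => k s *: f s)
     - bochner_integral mu [set: R] (fun s : R => k' s *: f s)|)%:E
   <= \int[mu]_(s in D) (`|k s - k' s| * `|f s|)%:E)%E.
Proof.
move=> mk mk' k0 k'0 ik ik'.
have sk : strongly_measurable (fun s : R => k s *: f s) by exact: strongly_measurableZ.
have sk' : strongly_measurable (fun s : R => k' s *: f s) by exact: strongly_measurableZ.
rewrite addrC -scaleN1r -bochner_integral_lin//; last 2 first.
- by rewrite integral_norm_kernelE.
- by rewrite integral_norm_kernelE.
apply: le_trans.
  by apply: le_norm_bochner_integral => //; exact: strongly_measurable_lin.
rewrite [leRHS]integral_mkcond; apply: le_lower_integral => s _.
  by rewrite lee_fin.
rewrite patchE scaleN1r addrC -scalerBl normrZ; case: ifPn => // .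
by rewrite notin_setE => /fD ->; rewrite normr0 mulr0.
Qed.

Lemma measurable_norm_f : measurable_fun [set: R] (fun s => `|f s|).
Proof. exact: strongly_measurable_norm. Qed.

Lemma RL_full_norm_le t : ((`|RL_full t|)%:E <= A t)%E.
Proof.
rewrite /A /RL_potential -integral_norm_kernelE; last by move=> s; exact: kern_ge0.
apply: le_norm_bochner_integral => //; exact: strongly_measurable_kern.
Qed.

(** The step kernels lie between 0 and the kernel, so the error is dominated by
    [kern q^-1 (t - s) * |f s|], which is integrable because [A t] is finite. *)
Lemma RL_full_approx : exists2 w : nat -> R -> X, (forall n, simple_fun (w n)) &
  forall t, D t -> (A t < +oo)%E -> w n t @[n --> \oo] --> RL_full t.
Proof.
pose W n k := bochner_integral mu [set: R] (fun s : R => RL_step_kernel t0 q^-1 n k s *: f s).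
exists (fun n t => if (if t \in D then Some (RL_step t0 n t) else None) is Some k
                   then W n k else 0).
  move=> n; exact: (simple_fun_comp (fun o => if o is Some k then W n k else 0)
    (simple_fun_RL_step t0 t1 n)).
move=> t Dt At; have t0t : t0 <= t by move: Dt; rewrite /= in_itv/= => /andP[].
rewrite (mem_set (Dt : D t)).
have mkt : measurable_fun [set: R] (fun s : R => kern q^-1 (t - s)).
  by apply: (measurableT_comp (measurable_kern _)); exact: measurable_funB.
have mnf := measurable_norm_f.
pose g n s := `|RL_step_kernel t0 q^-1 n (RL_step t0 n t) s - kern q^-1 (t - s)| * `|f s|.
have le n : ((`|W n (RL_step t0 n t) - RL_full t|)%:E <= \int[mu]_(s in D) (g n s)%:E)%E.
  apply: bochner_integral_kernel_dist => //.
  - exact: measurable_RL_step_kernel.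
  - by move=> s; have /andP[] := RL_step_kernel_le b0 n s t0t.
  - by move=> s; exact: kern_ge0.
  - apply: le_lt_trans At; apply: le_lower_integral => s _; rewrite lee_fin.
      by rewrite mulr_ge0//; have /andP[] := RL_step_kernel_le b0 n s t0t.
    by rewrite ler_wpM2r//; have /andP[] := RL_step_kernel_le b0 n s t0t.
have lim0 : (\int[mu]_(s in D) (g n s)%:E)%E @[n --> \oo] --> 0%E.
  have mD : measurable D by exact: measurable_itv.
  have iA : mu.-integrable D (fun s => (kern q^-1 (t - s) * `|f s|)%:E).
    apply/integrableP; split.
      by apply/measurable_EFinP/measurable_funTS; exact: measurable_funM.
    under eq_integral do rewrite /= ger0_norm ?mulr_ge0 ?kern_ge0//.
    exact: At.
  have := @dominated_convergence _ _ R mu D mD (fun n s => (g n s)%:E) (cst 0%E) _ _ _ _ iA _.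
  case=> //.
  - move=> n; apply/measurable_EFinP/measurable_funTS; apply: measurable_funM => //.
    apply: measurableT_comp => //; apply: measurable_funB => //.
    exact: measurable_RL_step_kernel.
  - apply: aeW => s _; apply: cvg_EFin; first exact: nearW.
    rewrite -(mul0r `|f s|); apply: cvgM; last exact: cvg_cst.
    rewrite -(normr0 R) -(subrr (kern q^-1 (t - s))); apply: cvg_norm.
    apply: cvgB; last exact: cvg_cst.
    exact: RL_step_kernel_cvg.
  - apply: aeW => s n _; rewrite /= lee_fin /g normrM !normr_id ler_wpM2r//.
    have /andP[h1 h2] := RL_step_kernel_le b0 n s t0t.
    by rewrite distrC ger0_norm ?subr_ge0// gerBl.
  - by rewrite integral0.
apply/cvgrPdistC_lt => e e0.
have : \forall n \near \oo, (\int[mu]_(s in D) (g n s)%:E < e%:E)%E.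
  have e0' : (0 < e%:E)%E by rewrite lte_fin.
  exact: (lim0 _ (open_ereal_lt' e0')).
apply: filterS => n hn; rewrite -lte_fin; exact: le_lt_trans (le n) hn.
Qed.

End RL_bochner.

#[local] Instance lebesgue_ae_filter (R : realType) :
  Filter (nbhs (almost_everywhere (@lebesgue_measure R))).
Proof. exact: ae_filter_ringOfSetsType. Qed.

Section Lr_norm.
Context (R : realType) (X : completeNormedModType R).
Notation mu := (@lebesgue_measure R).
Implicit Types (D : set R) (r c : R) (g : R -> X).

Lemma Lr_normE D r g : 0 < r ->
  Lr_norm D r g = ((\int[mu]_(x in D) (`|g x| `^ r)%:E) `^ r^-1)%E.
Proof.
move=> r0; rewrite /Lr_norm unlock /Lnorm; apply: (congr1 (poweR^~ r^-1)).
rewrite [RHS]integral_mkcond; apply: eq_integral => x _.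
rewrite /= !patchE; case: ifPn => _; first by rewrite normr_id.
by rewrite normr0 powR0// gt_eqF.
Qed.

Let nneg_itv (x : \bar R) : (0 <= x)%E -> x \in `[0%E, +oo%E].
Proof. by move=> x0; rewrite in_itv/= x0 leey. Qed.

Let int0 D r g : (0 <= \int[mu]_(x in D) (`|g x| `^ r)%:E)%E.
Proof. by apply: integral_ge0 => x _; rewrite lee_fin powR_ge0. Qed.

(** Bridge between the norms of the theorem and the power bounds of [hoelder_le], without
    measurability of [g]. *)
Lemma Lr_norm_leP D r c g : 0 < r -> 0 <= c ->
  (Lr_norm D r g <= c%:E)%E <-> (\int[mu]_(x in D) (`|g x| `^ r)%:E <= (c `^ r)%:E)%E.
Proof.
move=> r0 c0; rewrite Lr_normE//; split => h.
  rewrite -[leLHS]poweRe1// -(mulVf (lt0r_neq0 r0)) poweRrM -poweR_EFin.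
  apply: gt0_ler_poweR => //; [exact: ltW|exact/nneg_itv/poweR_ge0|exact: nneg_itv].
rewrite -[leRHS]poweRe1 ?lee_fin// -(mulfV (lt0r_neq0 r0)) poweRrM poweR_EFin.
apply: gt0_ler_poweR => //; first by rewrite invr_ge0 ltW.
  exact: nneg_itv.
by apply: nneg_itv; rewrite lee_fin powR_ge0.
Qed.

Lemma Lr_norm_ge0 D r g : 0 < r -> (0 <= Lr_norm D r g)%E.
Proof. by move=> r0; rewrite Lr_normE// poweR_ge0. Qed.

End Lr_norm.

(** * Norm and oscillation bounds for the fractional integral *)

Section RL_bounds.
Context (R : realType) (X : completeNormedModType R).
Notation mu := (@lebesgue_measure R).
Variables (t0 t1 p q : R).
Hypotheses (t01 : t0 < t1) (p1 : 1 < p) (q1 : 1 < q) (pq : p^-1 + q^-1 = 1).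
Notation D := (`[t0, t1]%classic).
Variables (f0 f : R -> X) (m : R).
Hypotheses (mf : strongly_measurable f) (fD : forall x, ~ D x -> f x = 0).
Hypothesis f0f : {ae mu, forall x, D x -> f0 x = f x}.
Hypotheses (m0 : 0 < m) (hm : (Lr_norm D p f0 <= m%:E)%E).
Notation A := (RL_potential t0 t1 q f).
Notation c := ((Gamma p^-1)^-1).

Let p0 : 0 < p. Proof. exact: lt_trans p1. Qed.
Let q0 : 0 < q. Proof. exact: lt_trans q1. Qed.
Let mD : measurable D. Proof. exact: measurable_itv. Qed.
Let mnf := measurable_norm_f mf.
Let nf0 x : 0 <= `|f x|. Proof. exact: normr_ge0. Qed.

Let hfm : (\int[mu]_(x in D) (`|f x| `^ p)%:E <= (m `^ p)%:E)%E.
Proof.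
move/(Lr_norm_leP _ _ p0 (ltW m0)) : hm; apply: le_trans.
apply: ae_le_lower_integral => [x _|x _|]; rewrite ?lee_fin ?powR_ge0//.
by apply: filterS f0f => x + Dx => /(_ Dx) ->.
Qed.

Let moment r : 1 <= r -> (\int[mu]_(t in D) (A t `^ r) <=
  ((4 * (1 + (t1 - t0)) ^+ 3 * (p + q) `^ q^-1 * r `^ q^-1 * m) `^ r)%:E)%E.
Proof. exact: (RL_moment t01 p1 q1 pq mnf nf0 m0 hfm). Qed.

Let A0 t : (0 <= A t)%E.
Proof. by apply: integral_ge0 => s _; rewrite lee_fin mulr_ge0// kern_ge0. Qed.

Let mA : measurable_fun D A.
Proof.
apply: (@measurable_fun_integral_on _ _ _ _ R mu D D
  (fun z : R * R => kern q^-1 (z.1 - z.2) * `|f z.2|)) => //.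
- apply: measurable_funM; last exact: (measurableT_comp mnf).
  by apply: (measurableT_comp (measurable_kern _)); exact: measurable_funB.
- by move=> z; rewrite mulr_ge0// kern_ge0.
Qed.

(** The moment bound with [r = 1] makes the potential integrable, hence finite almost everywhere. *)
Lemma RL_potential_lty : {ae mu, forall t, D t -> (A t < +oo)%E}.
Proof.
have iA : mu.-integrable D A.
  apply/integrableP; split => //.
  under eq_integral do rewrite gee0_abs//.
  apply: le_lt_trans (ltry _).
  have := moment (lexx 1); apply: le_trans.
  apply: le_lower_integral => t _ //; by rewrite poweRe1.
have fin : {ae mu, forall x, D x -> A x \is a fin_num} by apply: integrable_ae iA.
apply: filterS fin => t + Dt => /(_ Dt).
by rewrite ge0_fin_numE.
Qed.

Lemma RL_integral_rep t : D t -> (A t < +oo)%E ->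
  RL_integral t0 p^-1 f0 t = c *: RL_full q f t.
Proof.
move=> Dt At; rewrite /RL_integral -(bochner_integral_RL q1 pq mf fD Dt At).
congr (_ *: _); apply: ae_eq_bochner_integral.
apply: filterS f0f => s fs st; rewrite /RL_kernel fs//.
move: Dt st; rewrite /= !in_itv/= => /andP[_ tt1] /andP[-> st].
exact: le_trans tt1.
Qed.

Let J := RL_integral t0 p^-1 f0.

Lemma RL_integral_norm_le :
  {ae mu, forall t, D t -> ((`|J t|)%:E <= (`|c|)%:E * A t)%E}.
Proof.
apply: filterS RL_potential_lty => t At Dt.
rewrite /J RL_integral_rep//; last exact: At.
by rewrite normrZ EFinM lee_wpmul2l ?lee_fin//; exact: RL_full_norm_le.
Qed.

Lemma RL_integral_bochner_measurable (K : set R) : K `<=` D ->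
  bochner_measurable mu K J.
Proof.
move=> KD; have [w sw wJ] := RL_full_approx q1 mf fD.
exists (fun n t => c *: w n t).
  by move=> n; exact: (simple_fun_comp (fun v : X => c *: v) (sw n)).
apply: filterS RL_potential_lty => t At /KD Dt.
rewrite /J RL_integral_rep//; last exact: At.
by apply: cvgZr; apply: wJ => //; exact: At.
Qed.

(** [K] serves as the whole interval, as a compact set for local integrability, and as [[a, b]] in
    the mean oscillation. *)
Lemma RL_integral_Lr_norm_le r (K : set R) : 1 <= r -> K `<=` D ->
  (Lr_norm K r J <= (`|c| *
     (4 * (1 + (t1 - t0)) ^+ 3 * (p + q) `^ q^-1) * r `^ q^-1 * m)%:E)%E.
Proof.
move=> r1 KD; have r0 : 0 < r by exact: lt_le_trans r1.
have S0 : 0 <= 4 * (1 + (t1 - t0)) ^+ 3 * (p + q) `^ q^-1.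
  by rewrite !mulr_ge0 ?powR_ge0// addr_ge0// subr_ge0 ltW.
apply/Lr_norm_leP => //.
  by rewrite mulr_ge0 ?(ltW m0)// mulr_ge0 ?powR_ge0// mulr_ge0.
apply: (@le_trans _ _ (\int[mu]_(t in D) ((`|c| `^ r)%:E * A t `^ r))%E).
  apply: (@le_trans _ _ (\int[mu]_(t in D) (`|J t| `^ r)%:E)%E).
    rewrite integral_mkcond [leRHS]integral_mkcond; apply: le_lower_integral => x _.
      by apply: erestrict_ge0 => y _; rewrite lee_fin powR_ge0.
    rewrite !patchE; case: ifPn => [/set_mem/KD/mem_set ->//|_].
    by case: ifPn => // _; rewrite lee_fin powR_ge0.
  apply: ae_le_lower_integral => [x _|x _|].
  - by rewrite lee_fin powR_ge0.
  - by rewrite mule_ge0 ?lee_fin ?powR_ge0 ?poweR_ge0.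
  apply: filterS RL_integral_norm_le => t + Dt => /(_ Dt) Jt.
  rewrite -!poweR_EFin -poweRM ?lee_fin//.
  by apply: gt0_ler_poweR; rewrite ?(ltW r0)// in_itv/= leey andbT ?mule_ge0 ?lee_fin.
rewrite ge0_integralZl_EFin ?powR_ge0//; last 2 first.
- by move=> t _; exact: poweR_ge0.
- exact: (measurableT_comp (measurable_poweR r) mA).
apply: (@le_trans _ _ ((`|c| `^ r)%:E *
  ((4 * (1 + (t1 - t0)) ^+ 3 * (p + q) `^ q^-1 * r `^ q^-1 * m) `^ r)%:E)%E).
  by rewrite lee_wpmul2l ?lee_fin ?powR_ge0//; exact: moment.
rewrite -EFinM -powRM ?lee_fin//; first by rewrite !mulrA.
by rewrite mulr_ge0 ?(ltW m0)// mulr_ge0 ?powR_ge0.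
Qed.

(** The factor 2 is the price of replacing the constant [d0] by the average: the average is itself
    within the mean distance of [d0]. *)
Lemma RL_integral_mean_oscillation_le a b : a < b -> `[a, b] `<=` `]t0, t1[ ->
  (mean_oscillation a b J <= (2 * `|c| * (1 + (2 * p) `^ q) * m)%:E)%E.
Proof.
move=> ab abt; have w0 : 0 < b - a by rewrite subr_gt0.
have abD : `[a, b]%classic `<=` D.
  by move=> x /abt; rewrite /= !in_itv/= => /andP[/ltW-> /ltW->].
set C := 1 + (2 * p) `^ q.
have C0 : 0 < C by rewrite ltr_wpDr ?powR_ge0.
have mab : measurable `[a, b]%classic by exact: measurable_itv.
pose k s := kcut q^-1 a (b - a) s.
have mk : measurable_fun [set: R] k by exact: measurable_kcut.
have k0 s : 0 <= k s by exact: kcut_ge0.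
pose Y t := (\int[mu]_(s in D) (`|kern q^-1 (t - s) - k s| * `|f s|)%:E)%E.
have intY : (\int[mu]_(t in `[a, b]) Y t <= (m * ((b - a) * C))%:E)%E.
  exact: (RL_oscillation p1 q1 pq mnf nf0 m0 hfm ab).
have Y0 t : (0 <= Y t)%E by apply: integral_ge0 => s _; rewrite lee_fin mulr_ge0.
have mY : measurable_fun `[a, b]%classic Y.
  apply: (@measurable_fun_integral_on _ _ _ _ R mu `[a, b]%classic D
    (fun z : R * R => `|kern q^-1 (z.1 - z.2) - k z.2| * `|f z.2|)) => //.
  apply: measurable_funM; last exact: (measurableT_comp mnf).
  apply: measurableT_comp => //; apply: measurable_funB; last exact: (measurableT_comp mk).
  by apply: (measurableT_comp (measurable_kern _)); exact: measurable_funB.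
have intk : (\int[mu]_(s in D) (k s * `|f s|)%:E < +oo)%E.
  apply: (@le_lt_trans _ _ (\int[mu]_(s in D) (`|f s| * (b - a) `^ (- q^-1))%:E)%E).
    apply: le_lower_integral => s _; first by rewrite lee_fin mulr_ge0.
    rewrite lee_fin mulrC ler_wpM2l// /k /kcut; case: ifPn => [saw|_]; last exact: powR_ge0.
    have h : b - a <= a - s by lra.
    rewrite kern_gt0 ?(lt_le_trans w0)// !powRN lef_pV2 ?posrE ?powR_gt0 ?(lt_le_trans w0)//.
    by apply: ge0_ler_powR; rewrite ?nnegrE ?invr_ge0 ?(ltW q0)//; lra.
  apply: le_lt_trans (ltry (m * ((t1 - t0) `^ q^-1 * (b - a) `^ (- q^-1)))).
  apply: (@hoelder_le _ _ R mu D (fun s => `|f s|) (fun=> (b - a) `^ (- q^-1)) p q) => //.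
  - by move=> _; exact: powR_ge0.
  - exact: ltW.
  - by rewrite mulr_ge0 ?powR_ge0.
  - rewrite integral_cst//= lebesgue_measure_itv/= lte_fin t01 -EFinM lee_fin.
    have T0 : 0 <= t1 - t0 by rewrite subr_ge0 ltW.
    have TE : ((t1 - t0) `^ q^-1) `^ q = t1 - t0.
      by rewrite -powRrM mulVf ?powRr1// gt_eqF.
    by rewrite powRM ?powR_ge0// TE mulrC.
pose d0 := c *: bochner_integral mu [set: R] (fun s : R => k s *: f s).
have Jd0 : {ae mu, forall t, `[a, b]%classic t -> ((`|J t - d0|)%:E <= (`|c|)%:E * Y t)%E}.
  apply: filterS RL_potential_lty => t At /abD Dt.
  rewrite /J RL_integral_rep//; last exact: At.
  rewrite -scalerBr normrZ EFinM lee_wpmul2l ?lee_fin//.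
  apply: bochner_integral_kernel_dist => //; last exact: At.
  - by apply: (measurableT_comp (measurable_kern _)); exact: measurable_funB.
  - by move=> s; exact: kern_ge0.
set z := `|c| * m * C.
have z0 : 0 <= z by rewrite !mulr_ge0// ltW.
have intcY : (\int[mu]_(t in `[a, b]) ((`|c|)%:E * Y t) <= (z * (b - a))%:E)%E.
  rewrite ge0_integralZl_EFin//.
  apply: (@le_trans _ _ ((`|c|)%:E * (m * ((b - a) * C))%:E)%E).
    by rewrite lee_wpmul2l ?lee_fin.
  by rewrite -EFinM lee_fin /z (_ : `|c| * (m * ((b - a) * C)) = `|c| * m * C * (b - a))//; ring.
have bJ := RL_integral_bochner_measurable abD.
(* Linearity of the integral and its norm bound need strong measurability, which [J] has only up to
   a null set. *)
have [G [mG _ JG]] : exists G : R -> X, [/\ strongly_measurable G,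
    (forall x, ~ `[a, b]%classic x -> G x = 0) &
    {ae mu, forall x, `[a, b]%classic x -> J x = G x}].
  exact: bochner_measurable_rep bJ.
have intG : (\int[mu]_(x in `[a, b]) (`|G x|)%:E < +oo)%E.
  have hJ := RL_integral_Lr_norm_le (lexx 1) abD.
  apply: (@le_lt_trans _ _ (\int[mu]_(x in `[a, b]) (`|J x| `^ 1)%:E)%E).
    apply: ae_le_lower_integral => //.
    by apply: filterS JG => x JG abx; rewrite powRr1// JG.
  have := hJ; move/(Lr_norm_leP _ _ ltr01) => h; apply: le_lt_trans (h _) (ltry _).
  by rewrite !mulr_ge0 ?powR_ge0 ?(ltW m0)// addr_ge0// subr_ge0 ltW.
have mu_ab : mu `[a, b]%classic = (b - a)%:E.
  by rewrite lebesgue_measure_itv/= lte_fin ab.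
(* The deviation of the average from [d0] is the average of [J - d0]. *)
have avgE : avg a b J - d0 =
    (b - a)^-1 *: bochner_integral mu `[a, b] (fun x => -1 *: d0 + G x).
  have -> : bochner_integral mu `[a, b] (fun x : R => -1 *: d0 + G x) =
      -1 *: bochner_integral mu `[a, b] (fun=> d0) + bochner_integral mu `[a, b] G.
    apply: bochner_integral_lin => //; first exact: strongly_measurable_cst.
    by rewrite integral_cst//= mu_ab -EFinM ltry.
  rewrite bochner_integral_cst//=; last by rewrite mu_ab ltry.
  rewrite mu_ab /= scalerDr scaleN1r scalerN scalerA mulVf ?gt_eqF// scale1r [RHS]addrC.
  rewrite /avg; congr (_ *: _ - _); exact: ae_eq_bochner_integral.
have avgd0 : `|avg a b J - d0| <= z.
  rewrite avgE normrZ ger0_norm ?invr_ge0 ?(ltW w0)// mulrC ler_pdivrMr// -lee_fin.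
  apply: le_trans intcY; apply: le_trans.
    apply: le_norm_bochner_integral => //; apply: strongly_measurable_lin => //.
    exact: strongly_measurable_cst.
  apply: ae_le_lower_integral => [x _|x _|].
  - by rewrite lee_fin.
  - by rewrite mule_ge0.
  apply: filterS2 JG Jd0 => x JG Jd0 abx.
  by rewrite scaleN1r addrC -JG//; exact: Jd0.
have intosc : (\int[mu]_(s in `[a, b]) (`|J s - avg a b J|)%:E <= (2 * z * (b - a))%:E)%E.
  apply: (@le_trans _ _ (\int[mu]_(t in `[a, b]) ((`|c|)%:E * Y t + z%:E))%E).
    apply: ae_le_lower_integral => [x _|x _|].
    - by rewrite lee_fin.
    - by rewrite adde_ge0// mule_ge0.
    apply: filterS Jd0 => x Jd0 abx.
    apply: (@le_trans _ _ ((`|J x - d0|)%:E + (`|d0 - avg a b J|)%:E)%E).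
      by rewrite -EFinD lee_fin; exact: ler_distD.
    by apply: leeD; [exact: Jd0|rewrite lee_fin distrC].
  rewrite ge0_integralD//; last 2 first.
  - by move=> x _; rewrite mule_ge0.
  - exact: measurable_funeM.
  rewrite integral_cst//= mu_ab -EFinM.
  apply: (@le_trans _ _ ((z * (b - a))%:E + (z * (b - a))%:E)%E).
    by rewrite leeD2r.
  by rewrite -EFinD lee_fin -mulrA [X in _ <= X]mulr_natl mulr2n.
rewrite /mean_oscillation.
apply: (@le_trans _ _ ((b - a)^-1%:E * (2 * z * (b - a))%:E)%E).
  by rewrite lee_wpmul2l// lee_fin invr_ge0 ltW.
rewrite -EFinM lee_fin mulrC mulfK ?gt_eqF// /z.
by rewrite (_ : 2 * (`|c| * m * C) = 2 * `|c| * C * m)//; ring.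
Qed.

End RL_bounds.

(** * The operator: existence, linearity, range and boundedness *)

Lemma ae_eq_RL_kernel (R : realType) (X : completeNormedModType R)
    (t0 t1 alpha t : R) (f g : R -> X) : `[t0, t1]%classic t ->
  ae_eq_on `[t0, t1] f g ->
  {ae @lebesgue_measure R, forall s, `[t0, t]%classic s ->
    RL_kernel alpha f t s = RL_kernel alpha g t s}.
Proof.
move=> Dt; apply: filterS => s fs st; rewrite /RL_kernel fs//.
move: Dt st; rewrite /= !in_itv/= => /andP[_ tt1] /andP[-> st].
exact: le_trans tt1.
Qed.

Unset Implicit Arguments.
Set Strict Implicit.

Theorem theorem31 (R : realType) (X : completeNormedModType R)
    (t0 t1 p gamma : R) (ht : t0 < t1) (hp : 1 < p)
    (hgamma : (p - 1) / p <= gamma) :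
  (* the operator is well defined: the integral exists for a.e. t *)
  (forall f : R -> X, in_Lr `[t0, t1] p f ->
    {ae @lebesgue_measure R, forall t, `[t0, t1]%classic t ->
      bochner_integrable (@lebesgue_measure R) `[t0, t]
        (RL_kernel p^-1 f t)}) /\
  (* it does not depend on the representative *)
  (forall f g : R -> X, in_Lr `[t0, t1] p f -> in_Lr `[t0, t1] p g ->
    ae_eq_on `[t0, t1] f g ->
    ae_eq_on `[t0, t1] (RL_integral t0 p^-1 f) (RL_integral t0 p^-1 g)) /\
  (* it takes its values in the intersection of BMO and K_gamma *)
  (forall f : R -> X, in_Lr `[t0, t1] p f ->
    in_BMO t0 t1 (RL_integral t0 p^-1 f) /\
    in_K t0 t1 gamma (RL_integral t0 p^-1 f)) /\
  (* it is linear *)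
  (forall (c : R) (f g : R -> X),
    in_Lr `[t0, t1] p f -> in_Lr `[t0, t1] p g ->
    ae_eq_on `[t0, t1] (RL_integral t0 p^-1 (fun s => c *: f s + g s))
      (fun t => c *: RL_integral t0 p^-1 f t + RL_integral t0 p^-1 g t)) /\
  (* it is bounded *)
  (exists K : R, 0 < K /\ forall f : R -> X, in_Lr `[t0, t1] p f ->
    (BMO_K_norm t0 t1 gamma (RL_integral t0 p^-1 f)
       <= K%:E * Lr_norm `[t0, t1] p f)%E).
Proof.
pose mu := @lebesgue_measure R; set D := `[t0, t1]%classic.
have p0 : 0 < p by lra.
have p10 : 0 < p - 1 by lra.
pose q := p / (p - 1).
have q1 : 1 < q by rewrite /q ltr_pdivlMr//; lra.
have q0 : 0 < q by lra.
have qE : q^-1 = (p - 1) / p by rewrite /q invf_div.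
have pq : p^-1 + q^-1 = 1 by rewrite qE; field; rewrite gt_eqF.
have mD : measurable D by exact: measurable_itv.
have rep (f : R -> X) : in_Lr D p f -> exists g : R -> X, [/\ strongly_measurable g,
    (forall x, ~ D x -> g x = 0) & {ae mu, forall x, D x -> f x = g x}].
  by move=> [bf _]; exact: bochner_measurable_rep bf.
have bound (f : R -> X) : in_Lr D p f -> exists2 m : R, 0 < m & (Lr_norm D p f <= m%:E)%E.
  move=> [_ fy]; have f0 := Lr_norm_ge0 D f p0.
  have fN : Lr_norm D p f \is a fin_num by rewrite ge0_fin_numE.
  (* Adding 1 keeps the bound positive when the norm is 0; only finiteness is drawn from it. *)
  exists (fine (Lr_norm D p f) + 1); first by rewrite ltr_wpDl ?fine_ge0.
  by rewrite EFinD fineK// leeDl.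
set c := (Gamma p^-1)^-1.
pose C1 := 4 * (1 + (t1 - t0)) ^+ 3 * (p + q) `^ q^-1.
pose C2 := 1 + (2 * p) `^ q.
have C10 : 0 <= C1.
  by rewrite !mulr_ge0 ?powR_ge0// addr_ge0// subr_ge0 ltW.
have C20 : 0 <= C2 by rewrite addr_ge0 ?powR_ge0.
have BMO_le (f : R -> X) m : in_Lr D p f -> 0 < m -> (Lr_norm D p f <= m%:E)%E ->
    (BMO_seminorm t0 t1 (RL_integral t0 p^-1 f) <= (2 * `|c| * C2 * m)%:E)%E.
  move=> fp m0 fm; have [g [mg gD fg]] := rep f fp.
  apply: ge_ereal_sup => _ [a [b [ab abt ->]]].
  exact: (RL_integral_mean_oscillation_le ht hp q1 pq mg gD fg m0 fm ab abt).
have K_le (f : R -> X) m : in_Lr D p f -> 0 < m -> (Lr_norm D p f <= m%:E)%E ->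
    (K_norm t0 t1 gamma (RL_integral t0 p^-1 f) <= (`|c| * C1 * m)%:E)%E.
  move=> fp m0 fm; have [g [mg gD fg]] := rep f fp.
  apply: ge_ereal_sup => _ [r /= r1 <-].
  have r0 : 0 < r by exact: lt_le_trans r1.
  have h := RL_integral_Lr_norm_le ht hp q1 pq mg gD fg m0 fm r1 (@subset_refl _ D).
  apply: (@le_trans _ _ ((r `^ (- gamma))%:E * (`|c| * C1 * r `^ q^-1 * m)%:E)%E).
    by rewrite lee_wpmul2l// lee_fin powR_ge0.
  rewrite -EFinM lee_fin.
  have -> : r `^ (- gamma) * (`|c| * C1 * r `^ q^-1 * m) =
      `|c| * C1 * m * (r `^ (- gamma) * r `^ q^-1) by ring.
  rewrite ler_piMr//; first by rewrite mulr_ge0 ?(ltW m0)// mulr_ge0.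
  (* The hypothesis on [gamma] enters here: [1/q - gamma <= 0] and [r >= 1]. *)
  rewrite -powRD ?(gt_eqF r0) ?implybT// -(powRr0 r); apply: ler_powR => //.
  by rewrite qE; lra.
split; [|split; [|split; [|split]]].
- move=> f fp; have [g [mg gD fg]] := rep f fp; have [m m0 fm] := bound f fp.
  apply: filterS (RL_potential_lty ht hp q1 pq mg fg m0 fm) => t At Dt.
  apply: ae_bochner_integrable (bochner_integrable_RL q1 pq mg gD Dt (At Dt)).
  apply: ae_eq_RL_kernel Dt _.
  by apply: filterS fg => x fg Dx; rewrite fg.
(* The two values agree at every [t] of the interval, default values included. *)
- move=> f g _ _ fg; apply: aeW => t Dt; rewrite /RL_integral; congr (_ *: _).
  exact: ae_eq_bochner_integral (ae_eq_RL_kernel _ Dt fg).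
- move=> f fp; have [g [mg gD fg]] := rep f fp; have [m m0 fm] := bound f fp.
  have inL K r : K `<=` D -> 1 <= r -> in_Lr K r (RL_integral t0 p^-1 f).
    move=> KD r1; split.
      exact: (RL_integral_bochner_measurable ht hp q1 pq mg gD fg m0 fm).
    apply: le_lt_trans (ltry _).
    exact: (RL_integral_Lr_norm_le ht hp q1 pq mg gD fg m0 fm r1).
  split; split.
  + move=> K _ Kt; apply: inL => // x /Kt; rewrite /D /= !in_itv/= => /andP[h1 h2].
    by rewrite !ltW.
  + exact: le_lt_trans (BMO_le f m fp m0 fm) (ltry _).
  + by move=> r r1; apply: inL.
  + exact: le_lt_trans (K_le f m fp m0 fm) (ltry _).
- move=> k f g fp gp; have [f' [mf' fD' ff']] := rep f fp; have [g' [mg' gD' gg']] := rep g gp.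
  have [m m0 fm] := bound f fp; have [n n0 gn] := bound g gp.
  (* Additivity is claimed only where both potentials are finite; elsewhere default values could
     break it. *)
  apply: filterS2 (RL_potential_lty ht hp q1 pq mf' ff' m0 fm)
    (RL_potential_lty ht hp q1 pq mg' gg' n0 gn) => t At Bt Dt.
  pose Kf s := kern q^-1 (t - s) *: f' s; pose Kg s := kern q^-1 (t - s) *: g' s.
  have fE : {ae mu, forall s, `[t0, t]%classic s -> RL_kernel p^-1 f t s = Kf s}.
    apply: filterS (ae_eq_RL_kernel p^-1 Dt ff') => s h st; rewrite h//.
    by apply: (RL_kernelE q1 pq); move: st; rewrite /= in_itv/= => /andP[].
  have gE : {ae mu, forall s, `[t0, t]%classic s -> RL_kernel p^-1 g t s = Kg s}.
    apply: filterS (ae_eq_RL_kernel p^-1 Dt gg') => s h st; rewrite h//.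
    by apply: (RL_kernelE q1 pq); move: st; rewrite /= in_itv/= => /andP[].
  rewrite /RL_integral (ae_eq_bochner_integral fE) (ae_eq_bochner_integral gE).
  have fgE : {ae mu, forall s, `[t0, t]%classic s ->
      RL_kernel p^-1 (fun s => k *: f s + g s) t s = k *: Kf s + Kg s}.
    apply: filterS2 fE gE => s fs gs st; rewrite -(fs st) -(gs st) /RL_kernel.
    by rewrite scalerDr !scalerA mulrC.
  rewrite (ae_eq_bochner_integral fgE) bochner_integral_lin.
  + by rewrite scalerDr !scalerA mulrC.
  + exact: measurable_itv.
  + exact: strongly_measurable_kern.
  + exact: strongly_measurable_kern.
  + exact: (integral_kern_lty fD' Dt (At Dt)).
  + exact: (integral_kern_lty gD' Dt (Bt Dt)).
- pose K := 2 * `|c| * C2 + `|c| * C1 + 1.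
  have K0 : 0 < K by apply: ltr_wpDl => //; apply: addr_ge0; apply: mulr_ge0 => //; exact: mulr_ge0.
  exists K; split=> // f fp.
  have f0 := Lr_norm_ge0 D f p0.
  have fN : Lr_norm D p f \is a fin_num by rewrite ge0_fin_numE//; case: fp.
  apply/lee_addgt0Pr => e e0.
  (* Chosen so that [K m] is [K] times the norm plus [e], with [m] positive even for a zero norm;
     the final 1 in [K] makes the division by [K] legitimate. *)
  pose m := fine (Lr_norm D p f) + e / K.
  have m0 : 0 < m by rewrite ltr_wpDl ?fine_ge0// divr_gt0.
  have fm : (Lr_norm D p f <= m%:E)%E.
    by rewrite EFinD fineK// leeDl// lee_fin divr_ge0// ltW.
  apply: le_trans (leeD (BMO_le f m fp m0 fm) (K_le f m fp m0 fm)) _.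
  rewrite -(fineK fN) -EFinM -!EFinD lee_fin -mulrDl.
  apply: (@le_trans _ _ (K * m)).
    by rewrite ler_wpM2r ?(ltW m0)// /K lerDl.
  by rewrite /m mulrDr mulrCA mulfV ?mulr1// gt_eqF.
Qed.
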